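(* Assume that $Q_t,R_t$ ($t\in\mathbb{N}$) are positive definite, that $(C,A)$ is observable, and that $A$ is invertible. Let $\mathbf{K}_0\in\mathbb{R}^{N\times Mm}$ and let $\{\mathbf{K}_k\}$ be generated by exact gradient descent $\mathbf{K}_{k+1}=\mathbf{K}_k-\eta\nabla f(\mathbf{K}_k)$ with fixed step size $\eta>0$ satisfying $\eta\le\min\{c_3,c_4\}$, where $$c_3=\frac{\min\{1,\sigma_{\min}^{\Sigma}\}}{2\mathcal{B}(\mathbf{K}_0)\sqrt{M\,c_2(\mathbf{K}_0)^{-1}\big(f(\mathbf{K}_0)-f(\mathbf{K}^* )\big)}\;\frac{\rho_{\max}^{2M}-1}{\rho_{\max}^2-1}\,(2\rho_{\max}+1)\,\|\Sigma\|\max\{\|CA\|,1\}},$$ $$c_4=\frac{1}{4\big(\bar\sigma+\|CA\|^2\mathcal{A}(\mathbf{K}_0)\big)\big(\tfrac12+\mathcal{B}(\mathbf{K}_0)\big)},$$ $\rho_{\max}=\max\{\|A\|+\|CA\|\,\mathcal{C}(\mathbf{K}_0),\,1+b\}$ and $b>0$ is a small constant. Then for all $k\in\mathbb{N}$, $$f(\mathbf{K}_{k+1})-f(\mathbf{K}^* )\le(1-2\alpha)^{k+1}\big(f(\mathbf{K}_0)-f(\mathbf{K}^* )\big),\qquad \alpha=\frac{\eta}{8c_1}.$$ All remaining symbols are defined in the context.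
   Context: Let $M,N,m$ be positive integers, $A\in\mathbb{R}^{N\times N}$, $C\in\mathbb{R}^{m\times N}$, $\mathbb{T}=\{0,\dots,M-1\}$. $\|\cdot\|$ is the spectral norm; $\sigma_{\min}^{X},\sigma_{\max}^{X}$ are the minimal and maximal singular values of $X$. The system is $x_{t+1}=Ax_t+\omega_t$, $y_t=Cx_t+v_t$, $t\in\mathbb{N}$ ($0\in\mathbb N$), where $x_0\sim\mathcal N(\bar x_0,\Sigma_{x_0})$, $\{\omega_t\}$ and $\{v_t\}$ are Gaussian with zero mean, $\mathbb{E}[\omega_t\omega_t^T]=Q_t$, $\mathbb{E}[v_tv_t^T]=R_t$, and $x_0,\omega_t,v_t$ are mutually independent. For a gain $\mathbf{K}=(K_0,\dots,K_{M-1})$, $K_t\in\mathbb{R}^{N\times m}$, the estimates are generated by $\hat x_0=\bar x_0$, $\hat x_{t+1}=A\hat x_t+K_tCA(x_t-\hat x_t)+K_tC\omega_t+K_tv_{t+1}$. Put $P_0=\mathbb{E}[(x_0-\hat x_0)(x_0-\hat x_0)^T]$, $\Sigma=\sum_{n=1}^{N}(CA^n)^TCA^n$ and $$f(\mathbf{K})=\mathbb{E}\Big[\mathrm{tr}\Big(\sum_{t=0}^{M-1}(x_{t+1}-\hat x_{t+1})(x_{t+1}-\hat x_{t+1})^T\Sigma\Big)\Big].$$ $\nabla f(\mathbf{K})=(\nabla_0f(\mathbf{K}),\dots,\nabla_{M-1}f(\mathbf{K}))$, where $\nabla_tf$ is the gradient with respect to $K_t$, and $\mathbf{K}^*$ is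 the minimizer of $f$ over $\mathbb{R}^{N\times Mm}$. Further notation: $\underline\sigma=\min_{t\in\mathbb{T}}\sigma_{\min}^{R_{t+1}}$, $\bar\sigma=\max_{t\in\mathbb{T}}\sigma_{\max}^{CQ_tC^T+R_{t+1}}$, $q=\min_{t\in\mathbb{T}}\sigma_{\min}^{A^{-1}Q_tA^{-T}}$; $$\mathcal{A}(\mathbf{K})=\frac{f(\mathbf{K})}{\sigma_{\min}^{\Sigma}}+\|P_0\|,\qquad \mathcal{B}(\mathbf{K})=\frac{f(\mathbf{K})}{q}+N\sigma_{\max}^{\Sigma},$$ $$c_1=\frac{\mathcal{B}(\mathbf{K}^* )}{4\underline\sigma(\sigma_{\min}^{\Sigma})^2},\qquad c_2(\mathbf{K})=\frac{\sigma_{\min}^{\Sigma}}{4(\bar\sigma+\|CA\|^2\mathcal{A}(\mathbf{K}))},$$ $$\mathcal{C}(\mathbf{K})=\frac{\sqrt{M\,c_2(\mathbf{K})^{-1}(f(\mathbf{K})-f(\mathbf{K}^* ))}+\mathcal{A}(\mathbf{K})\|CA\|\|A\|}{\underline\sigma}+\sum_{t=0}^{M-1}\frac{\|CQ_t\|}{\underline\sigma}.$$ *)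

(* Defs.v *)
From HB Require Import structures.
From mathcomp Require Import all_boot all_order all_algebra finmap.
From mathcomp Require Import all_classical all_reals all_analysis.

Set Implicit Arguments.
Unset Strict Implicit.
Unset Printing Implicit Defensive.

Import Order.TTheory GRing.Theory Num.Theory.
Local Open Scope classical_set_scope.
Local Open Scope ring_scope.

Section Matrices.
Context {R : realType}.

Definition singular_value p q (X : 'M[R]_(p, q)) : set R :=
  [set s | 0 <= s /\ eigenvalue (X^T *m X) (s ^+ 2)].

(* For p < q the set above contains the eigenvalue 0 of X^T X, so the least
   singular value is defined for square matrices only. *)
Definition sigma_min n (X : 'M[R]_n) : R := inf (singular_value X).

Definition sigma_max p q (X : 'M[R]_(p, q)) : R := sup (singular_value X).

Definition spectral_norm p q (X : 'M[R]_(p, q)) : R := sigma_max X.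

Definition posdef n (S : 'M[R]_n) : Prop :=
  S^T = S /\ forall x : 'cV[R]_n, x != 0 -> 0 < (x^T *m S *m x) 0 0.

Definition observable N m (C : 'M[R]_(m, N)) (A : 'M[R]_N) : Prop :=
  \rank (\mxcol_(i < N) (C *m A ^+ i)) = N.

End Matrices.

Section RandomVectors.
Context {R : realType} {d : measure_display} {Omega : measurableType d}.
Variable P : probability Omega R.

(* Degenerate normal laws (s = 0) are Dirac masses; the library's
   [normal_prob mu 0] is a different convention. *)
Definition gaussian_vector n (X : Omega -> 'cV[R]_n) : Prop :=
  (forall i, measurable_fun setT (fun o => X o i 0)) /\
  forall a : 'cV[R]_n, exists mu s : R, 0 <= s /\
    forall B : set R, measurable B ->
      P [set o | B ((a^T *m X o) 0 0)] =
        if s == 0 then dirac mu B else normal_prob mu s B.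

(* Equality with finite numbers: a non-integrable function never has a finite
   expectation, so integrability of the entries is implied. *)
Definition has_mean n (X : Omega -> 'cV[R]_n) (mu : 'cV[R]_n) : Prop :=
  forall i, ('E_P[fun o => (X o i 0)%R])%E = (mu i 0)%:E.

Definition has_second_moment n (X : Omega -> 'cV[R]_n) (S : 'M[R]_n) : Prop :=
  forall i j, ('E_P[fun o => ((X o *m (X o)^T) i j)%R])%E = (S i j)%:E.

Definition multinormal n (X : Omega -> 'cV[R]_n) (mu : 'cV[R]_n)
    (S : 'M[R]_n) : Prop :=
  [/\ gaussian_vector X, has_mean X mu
    & has_second_moment (fun o => X o - mu) S].

Definition second_moment n (X : Omega -> 'cV[R]_n) : 'M[R]_n :=
  \matrix_(i, j) fine ('E_P[fun o => ((X o *m (X o)^T) i j)%R])%E.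

(* The sigma-algebra of the events {X in B}, B Borel in R^n, generated by the
   coordinates of X. *)
Definition sigma_of n (X : Omega -> 'cV[R]_n) : set (set Omega) :=
  <<s [set E | exists i (B : set R),
         measurable B /\ E = [set o | B (X o i 0)]] >>.

Definition mutually_independent (I : choiceType)
    (F : I -> set (set Omega)) : Prop :=
  forall (J : {fset I}) (E : I -> set Omega),
    (forall i, i \in J -> F i (E i)) ->
    P (\bigcap_(i in [set` J]) E i) = (\prod_(i <- J) P (E i))%E.

(* Index [None] stands for x_0, [inl t] for w_t and [inr t] for v_t. *)
Definition noise_sigma N m (x0 : Omega -> 'cV[R]_N)
    (w : nat -> Omega -> 'cV[R]_N) (v : nat -> Omega -> 'cV[R]_m)
    (i : option (nat + nat)) : set (set Omega) :=
  match i with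
  | None => sigma_of x0
  | Some (inl t) => sigma_of (w t)
  | Some (inr t) => sigma_of (v t)
  end.

End RandomVectors.

Notation gain R M N m := {ffun 'I_M -> 'M[R]_(N, m)}.

Section Gradient.
Context {R : realType} {M N m : nat}.

(* The steps t >= M are never used by the cost. *)
Definition gain_at (K : gain R M N m) (t : nat) : 'M[R]_(N, m) :=
  if insub t is Some i then K i else 0.

Definition gain_dir (t : 'I_M) (i : 'I_N) (j : 'I_m) : gain R M N m :=
  [ffun s => if s == t then delta_mx i j else 0].

Definition grad (f : gain R M N m -> R) (K : gain R M N m) : gain R M N m :=
  [ffun t => \matrix_(i, j) derive1 (fun h : R => f (K + h *: gain_dir t i j)) 0].

End Gradient.

Definition gramian {R : realType} {N m : nat} (A : 'M[R]_N)
    (C : 'M[R]_(m, N)) : 'M[R]_N :=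
  \sum_(1 <= n < N.+1) (C *m A ^+ n)^T *m (C *m A ^+ n).

Section Cost.
Context {R : realType} {d : measure_display} {Omega : measurableType d}.
Variable P : probability Omega R.
Context {M N m : nat}.
Variables (A : 'M[R]_N) (C : 'M[R]_(m, N)) (xbar0 : 'cV[R]_N).
Variables (x0 : Omega -> 'cV[R]_N) (w : nat -> Omega -> 'cV[R]_N).
Variable v : nat -> Omega -> 'cV[R]_m.

Fixpoint state (t : nat) (o : Omega) : 'cV[R]_N :=
  if t is s.+1 then A *m state s o + w s o else x0 o.

Fixpoint estimate (K : gain R M N m) (t : nat) (o : Omega) : 'cV[R]_N :=
  if t is s.+1 then
    A *m estimate K s o
    + gain_at K s *m C *m A *m (state s o - estimate K s o)
    + gain_at K s *m C *m w s o + gain_at K s *m v s.+1 o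
  else xbar0.

Definition est_error (K : gain R M N m) (t : nat) (o : Omega) : 'cV[R]_N :=
  state t o - estimate K t o.

Definition cost (K : gain R M N m) : R :=
  fine ('E_P[fun o => (\tr (\sum_(t < M)
    est_error K t.+1 o *m (est_error K t.+1 o)^T *m gramian A C))%R])%E.

End Cost.

Section Constants.
Context {R : realType} {M N m : nat}.
Variables (A : 'M[R]_N) (C : 'M[R]_(m, N)).
Variables (Q : nat -> 'M[R]_N) (Rv : nat -> 'M[R]_m) (P0 : 'M[R]_N).
Variables (f : gain R M N m -> R) (Kstar : gain R M N m).

Let Sg := gramian A C.
Let CA := C *m A.

(* Minimum and maximum over {0, ..., M-1}; since M > 0 the seed F 0 is one of
   the values. *)
Definition min_time (F : nat -> R) : R := \big[Order.min/F 0%N]_(t < M) F t.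
Definition max_time (F : nat -> R) : R := \big[Order.max/F 0%N]_(t < M) F t.

Definition sigma_low : R := min_time (fun t => sigma_min (Rv t.+1)).

Definition sigma_bar : R :=
  max_time (fun t => sigma_max (C *m Q t *m C^T + Rv t.+1)).

Definition q_low : R :=
  min_time (fun t => sigma_min (invmx A *m Q t *m (invmx A)^T)).

Definition calA (K : gain R M N m) : R := f K / sigma_min Sg + spectral_norm P0.

Definition calB (K : gain R M N m) : R := f K / q_low + N%:R * sigma_max Sg.

Definition c1 : R := calB Kstar / (4 * sigma_low * sigma_min Sg ^+ 2).

Definition c2 (K : gain R M N m) : R :=
  sigma_min Sg / (4 * (sigma_bar + spectral_norm CA ^+ 2 * calA K)).

Definition gap_root (K : gain R M N m) : R :=
  Num.sqrt (M%:R * (c2 K)^-1 * (f K - f Kstar)).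

Definition calC (K : gain R M N m) : R :=
  (gap_root K + calA K * spectral_norm CA * spectral_norm A) / sigma_low
  + \sum_(t < M) spectral_norm (C *m Q t) / sigma_low.

Definition rho_max (b : R) (K : gain R M N m) : R :=
  Num.max (spectral_norm A + spectral_norm CA * calC K) (1 + b).

(* Extended-real quotient, where 0^-1 = +oo: when f K = f Kstar the denominator
   vanishes and the constraint eta <= c3 is void. *)
Definition c3 (b : R) (K : gain R M N m) : \bar R :=
  let rho := rho_max b K in
  ((Num.min 1 (sigma_min Sg))%:E /
   (2 * calB K * gap_root K
    * ((rho ^+ (2 * M) - 1) / (rho ^+ 2 - 1)) * (2 * rho + 1)
    * spectral_norm Sg * Num.max (spectral_norm CA) 1)%:E)%E.

Definition c4 (K : gain R M N m) : R :=
  (4 * (sigma_bar + spectral_norm CA ^+ 2 * calA K) * (2^-1 + calB K))^-1.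

End Constants.

(* Main.v *)
From HB Require Import structures.
Require Import Defs.
From mathcomp Require Import all_boot all_order all_algebra finmap.
From mathcomp Require Import all_classical all_reals all_analysis.
From mathcomp Require Import measurable_realfun.
From mathcomp Require Import ring lra.

(* Let P_t be the covariance of the estimation error under the gains K, and let
   S_t be the cost-to-go weights: S_M = Sigma and
   S_t = Sigma + F_t^T S_{t+1} F_t with F_t = (1 - K_t C) A.  With
   Y_t = A P_t A^T + Q_t, W_t = C Y_t C^T + R_{t+1} and
   E_t = K_t W_t - Y_t C^T, telescoping gives for any two gains, D = K' - K,
     f(K') - f(K) = sum_t 2 <D_t, S'_{t+1} E_t> + <D_t, S'_{t+1} D_t W_t>,
   where S' belongs to K' and E, W belong to K.  Everything follows from this
   identity.  Since S'_{t+1} does not involve K'_t, the gradient is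
   2 S_{t+1} E_t; with K' = K* and completion of squares it yields gradient
   domination; with K' = K - E / w, w >= W_t, it bounds |E_t|, hence |K_t|, by
   the optimality gap.  Finally, for a gradient step c3 keeps S' within
   min(1, sigma_min) / 2 of S, by propagating the perturbation of the closed
   loop matrices F_t backwards in time, and c4 absorbs the quadratic term, so
   that f(K') <= f(K) - (eta / 4) |grad f(K)|^2. *)

(** The weights S' in the identity belong to the new gains, so a step is known to help only as far
    as S' can be compared with S. That comparison needs a bound on the closed loop matrices F_t,
    hence on the gains, and it has to come from the cost alone. Two dual estimates supply it. On the
    one hand sigma_min(Sigma) tr P_t <= tr(P_t Sigma) <= f for t >= 1, whence A(K). On the other
    hand the noise Q_t enters P_{t+1}, which S_{t+1} weights, so f also controls tr(F_t^T S_{t+1}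
    F_t), whence B(K). The constants of the step size are taken at K_0 because no step increases f,
    so the iterates stay in the sublevel set of K_0. Only c1 is taken at the minimizer: completing
    the square leaves the weights of the second gain of the identity. The decrease by (eta / 4)
    |grad f|^2 and domination with constant c1 combine to the factor 1 - eta / (4 c1) = 1 - 2
    alpha. *)

Set Implicit Arguments.
Unset Strict Implicit.
Unset Printing Implicit Defensive.

Import Order.TTheory GRing.Theory Num.Theory.
Local Open Scope ring_scope.

(** * Frobenius product and positive semidefinite matrices *)

Section FrobeniusProduct.
Context {R : realType}.

Definition mdot p q (X Y : 'M[R]_(p, q)) : R := \tr (X^T *m Y).

Definition fnorm p q (X : 'M[R]_(p, q)) : R := Num.sqrt (mdot X X).

Lemma mdotE p q (X Y : 'M[R]_(p, q)) :
  mdot X Y = \sum_j \sum_i X i j * Y i j.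
Proof.
by apply: eq_bigr => j _; rewrite mxE; apply: eq_bigr => i _; rewrite mxE.
Qed.

Lemma mdotC p q (X Y : 'M[R]_(p, q)) : mdot X Y = mdot Y X.
Proof. by rewrite /mdot -mxtrace_tr trmx_mul trmxK. Qed.

Lemma mdotDl p q (X Y Z : 'M[R]_(p, q)) : mdot (X + Y) Z = mdot X Z + mdot Y Z.
Proof. by rewrite /mdot linearD/= mulmxDl linearD. Qed.

Lemma mdotDr p q (X Y Z : 'M[R]_(p, q)) : mdot X (Y + Z) = mdot X Y + mdot X Z.
Proof. by rewrite /mdot mulmxDr linearD. Qed.

Lemma mdotZl p q a (X Y : 'M[R]_(p, q)) : mdot (a *: X) Y = a * mdot X Y.
Proof. by rewrite /mdot linearZ/= -scalemxAl linearZ. Qed.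

Lemma mdotZr p q a (X Y : 'M[R]_(p, q)) : mdot X (a *: Y) = a * mdot X Y.
Proof. by rewrite /mdot -scalemxAr linearZ. Qed.

Lemma mdotNr p q (X Y : 'M[R]_(p, q)) : mdot X (- Y) = - mdot X Y.
Proof. by rewrite -scaleN1r mdotZr mulN1r. Qed.

Lemma mdotBr p q (X Y Z : 'M[R]_(p, q)) : mdot X (Y - Z) = mdot X Y - mdot X Z.
Proof. by rewrite mdotDr mdotNr. Qed.

Lemma mdot0l p q (X : 'M[R]_(p, q)) : mdot 0 X = 0.
Proof. by rewrite -(scale0r 0) mdotZl mul0r. Qed.

Lemma mdot_mull p q r (A : 'M[R]_(p, q)) (X : 'M[R]_(q, r)) Y :
  mdot (A *m X) Y = mdot X (A^T *m Y).
Proof. by rewrite /mdot trmx_mul mulmxA. Qed.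

Lemma mdot_tr p q (X Y : 'M[R]_(p, q)) : mdot X^T Y^T = mdot X Y.
Proof. by rewrite [RHS]mdotC /mdot trmxK mxtrace_mulC. Qed.

Lemma mdot_cols p q (X Y : 'M[R]_(p, q)) :
  mdot X Y = \sum_j mdot (col j X) (col j Y).
Proof.
rewrite mdotE; apply: eq_bigr => j _; rewrite mdotE big_ord1.
by apply: eq_bigr => i _; rewrite !mxE.
Qed.

Lemma mdot_delta p q i j (X : 'M[R]_(p, q)) : mdot (delta_mx i j) X = X i j.
Proof.
rewrite mdotE (bigD1 j)//= (bigD1 i)//= !mxE !eqxx mul1r.
rewrite [X in _ + X + _]big1 => [|k /negPf nk]; last by rewrite mxE nk mul0r.
rewrite big1 ?addr0// => k /negPf nk; rewrite big1// => l _.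
by rewrite mxE nk andbF mul0r.
Qed.

Lemma mdotxx_ge0 p q (X : 'M[R]_(p, q)) : 0 <= mdot X X.
Proof.
by rewrite mdotE; do 2 apply: sumr_ge0 => ? _; rewrite -expr2 sqr_ge0.
Qed.

Lemma mdotxx_eq0 p q (X : 'M[R]_(p, q)) : (mdot X X == 0) = (X == 0).
Proof.
apply/eqP/eqP => [|->]; last exact: mdot0l.
rewrite mdotE => h; apply/matrixP => i j; rewrite mxE; apply/eqP.
move/psumr_eq0P: h => /(_ _ j isT) h.
have /psumr_eq0P/(_ i isT)/eqP : \sum_i0 X i0 j * X i0 j = 0.
  by apply: h => k _; apply: sumr_ge0 => l _; rewrite -expr2 sqr_ge0.
by rewrite mulf_eq0 orbb; apply=> l _; rewrite -expr2 sqr_ge0.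
Qed.

Lemma quadratic_ge0 (a b c : R) : 0 <= c ->
  (forall t, 0 <= a + 2 * b * t + c * t ^+ 2) -> b ^+ 2 <= a * c.
Proof.
rewrite le_eqVlt => /predU1P[<-|c0] h; last first.
  have := h (- b / c).
  have -> : a + 2 * b * (- b / c) + c * (- b / c) ^+ 2 = a - b ^+ 2 / c.
    by field; rewrite gt_eqF.
  by rewrite subr_ge0 ler_pdivrMr.
have [->|b0] := eqVneq b 0; first by rewrite mulr0 expr0n.
(* With [c = 0] the polynomial is affine; at this point its value is -1, so [b] must vanish. *)
have := h (- (a + 1) / (2 * b)); rewrite mul0r addr0.
have -> : 2 * b * (- (a + 1) / (2 * b)) = - (a + 1) by field.
lra.
Qed.

Lemma mdot_CS p q (X Y : 'M[R]_(p, q)) :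
  mdot X Y ^+ 2 <= mdot X X * mdot Y Y.
Proof.
apply: quadratic_ge0 => [|t]; first exact: mdotxx_ge0.
have := mdotxx_ge0 (X + t *: Y).
rewrite !(mdotDl, mdotDr, mdotZl, mdotZr) (mdotC Y X); congr (_ <= _); ring.
Qed.

Lemma fnorm_ge0 p q (X : 'M[R]_(p, q)) : 0 <= fnorm X.
Proof. exact: sqrtr_ge0. Qed.

Lemma sqr_fnorm p q (X : 'M[R]_(p, q)) : fnorm X ^+ 2 = mdot X X.
Proof. by rewrite sqr_sqrtr// mdotxx_ge0. Qed.

Lemma fnorm0 p q : fnorm (0 : 'M[R]_(p, q)) = 0.
Proof. by rewrite /fnorm mdot0l sqrtr0. Qed.

Lemma fnorm_gt0 p q (X : 'M[R]_(p, q)) : (0 < fnorm X) = (X != 0).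
Proof. by rewrite sqrtr_gt0 lt_def mdotxx_eq0 mdotxx_ge0 andbT. Qed.

Lemma fnormZ p q a (X : 'M[R]_(p, q)) : fnorm (a *: X) = `|a| * fnorm X.
Proof.
rewrite /fnorm mdotZl mdotZr mulrA -expr2 sqrtrM ?sqr_ge0//.
by rewrite sqrtr_sqr.
Qed.

Lemma fnormN p q (X : 'M[R]_(p, q)) : fnorm (- X) = fnorm X.
Proof. by rewrite -scaleN1r fnormZ normrN1 mul1r. Qed.

Lemma fnorm_tr p q (X : 'M[R]_(p, q)) : fnorm X^T = fnorm X.
Proof. by rewrite /fnorm mdot_tr. Qed.

Lemma normr_mdot_le p q (X Y : 'M[R]_(p, q)) : `|mdot X Y| <= fnorm X * fnorm Y.
Proof.
rewrite -ler_sqr ?nnegrE ?mulr_ge0 ?fnorm_ge0//.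
by rewrite real_normK ?num_real// exprMn !sqr_fnorm mdot_CS.
Qed.

Lemma mdot_le p q (X Y : 'M[R]_(p, q)) : mdot X Y <= fnorm X * fnorm Y.
Proof. by rewrite (le_trans (ler_norm _)) ?normr_mdot_le. Qed.

Lemma fnormD p q (X Y : 'M[R]_(p, q)) : fnorm (X + Y) <= fnorm X + fnorm Y.
Proof.
rewrite -ler_sqr ?nnegrE ?addr_ge0 ?fnorm_ge0//.
rewrite sqr_fnorm !(mdotDl, mdotDr) (mdotC Y X) -!sqr_fnorm.
have := mdot_le X Y; lra.
Qed.

Lemma fnormM p q r (X : 'M[R]_(p, q)) (Y : 'M[R]_(q, r)) :
  fnorm (X *m Y) <= fnorm X * fnorm Y.
Proof.
rewrite -ler_sqr ?nnegrE ?mulr_ge0 ?fnorm_ge0// exprMn !sqr_fnorm.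
rewrite -(mdot_tr X) (mdot_cols X^T) (mdot_cols Y) mdotE mulr_sumr.
apply: ler_sum => j _; rewrite mulr_suml; apply: ler_sum => i _.
have -> : (X *m Y) i j = mdot (col i X^T) (col j Y).
  by rewrite mdotE big_ord1 mxE; apply: eq_bigr => k _; rewrite !mxE.
by rewrite -expr2 mdot_CS.
Qed.

End FrobeniusProduct.

Section PositiveSemidefinite.
Context {R : realType}.

Definition psd n (S : 'M[R]_n) : Prop :=
  S^T = S /\ forall x : 'cV[R]_n, 0 <= mdot x (S *m x).

(* The spectral norm of X is at most c, stated without a supremum. *)
Definition op_bound p q (X : 'M[R]_(p, q)) (c : R) : Prop :=
  forall x : 'cV[R]_q, fnorm (X *m x) <= c * fnorm x.

Lemma posdefE n (S : 'M[R]_n) :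
  posdef S <-> S^T = S /\ forall x : 'cV[R]_n, x != 0 -> 0 < mdot x (S *m x).
Proof.
have e (x : 'cV[R]_n) : (x^T *m S *m x) 0 0 = mdot x (S *m x).
  by rewrite /mdot mulmxA /mxtrace big_ord1.
by split=> -[sS pS]; split=> // x x0; [rewrite -e|rewrite e]; exact: pS.
Qed.

Lemma posdef_psd n (S : 'M[R]_n) : posdef S -> psd S.
Proof.
move=> /posdefE[sS pS]; split=> // x; have [->|x0] := eqVneq x 0.
  by rewrite mdot0l.
exact/ltW/pS.
Qed.

Lemma psd_mdot n r (S : 'M[R]_n) (Y : 'M[R]_(n, r)) :
  psd S -> 0 <= mdot Y (S *m Y).
Proof.
move=> [_ pS]; rewrite mdot_cols; apply: sumr_ge0 => j _.
by rewrite [col j (S *m Y)]colE -mulmxA -colE.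
Qed.

Lemma psdD n (S T : 'M[R]_n) : psd S -> psd T -> psd (S + T).
Proof.
move=> [sS pS] [sT pT]; split=> [|x]; first by rewrite linearD/= sS sT.
by rewrite mulmxDl mdotDr addr_ge0.
Qed.

Lemma psd0 n : psd (0 : 'M[R]_n).
Proof. by split=> [|x]; rewrite ?trmx0// mul0mx mdotC mdot0l. Qed.

Lemma psd_conj n r (S : 'M[R]_n) (X : 'M[R]_(r, n)) :
  psd S -> psd (X *m S *m X^T).
Proof.
move=> [sS pS]; split=> [|x]; first by rewrite !trmx_mul trmxK sS mulmxA.
by rewrite mdotC -!mulmxA mdot_mull mdotC.
Qed.

Lemma psd_congr n r (S : 'M[R]_n) (X : 'M[R]_(n, r)) :
  psd S -> psd (X^T *m S *m X).
Proof. by move=> pS; have := psd_conj X^T pS; rewrite trmxK. Qed.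

(** The quadratic form of [S] at [a *: X + Y], expanded: this is the completed square used in
    [gradient_domination]. *)
Lemma psd_mdotD n r a (S : 'M[R]_n) (X Y : 'M[R]_(n, r)) : psd S ->
  0 <= a * (a * mdot X (S *m X)) + 2 * a * mdot X (S *m Y) + mdot Y (S *m Y).
Proof.
move=> pS; have := psd_mdot (a *: X + Y) pS.
rewrite mulmxDr -scalemxAr !(mdotDl, mdotDr, mdotZl, mdotZr).
have -> : mdot Y (S *m X) = mdot X (S *m Y) by rewrite mdotC mdot_mull pS.1.
congr (_ <= _); ring.
Qed.

Lemma psd_scalar n a : 0 <= a -> psd (a%:M : 'M[R]_n).
Proof.
move=> a0; split=> [|x]; first by rewrite tr_scalar_mx.
by rewrite mul_scalar_mx mdotZr mulr_ge0 ?mdotxx_ge0.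
Qed.

Lemma psd_gram n r (Y : 'M[R]_(n, r)) : psd (Y *m Y^T).
Proof.
by have := psd_conj Y (psd_scalar r (@ler01 R)); rewrite mulmx1.
Qed.

(* Symmetric Gaussian elimination: a nonzero diagonal entry k is cleared by
   subtracting the rank one matrix s s^T / S k k, s being column k of S, and a
   zero diagonal entry forces column k to vanish. *)
Lemma psd_factor n (S : 'M[R]_n) :
  psd S -> exists r (Y : 'M[R]_(n, r)), S = Y *m Y^T.
Proof.
move=> pS.
suff /(_ n (leqnn n)) [r [Y [T [-> _ T0]]]] : forall k, (k <= n)%N ->
    exists r (Y : 'M[R]_(n, r)) T,
      [/\ S = Y *m Y^T + T, psd T & forall i j : 'I_n, (i < k)%N -> T i j = 0].
  exists r, Y; rewrite (_ : T = 0) ?addr0//; apply/matrixP => i j.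
  by rewrite T0// mxE.
elim=> [_|k IH kn].
  by exists 0, 0, S; rewrite mul0mx add0r.
have [r [Y [T [ST [sT pT] T0]]]] := IH (ltnW kn).
pose i := Ordinal kn; pose e : 'cV[R]_n := delta_mx i 0.
have T_sym a b : T a b = T b a by rewrite -[in LHS]sT mxE.
have Te : T *m e = col i T by rewrite colE.
have eT x : mdot e (T *m x) = mdot (col i T) x.
  by rewrite -Te mdot_mull sT.
have ee : mdot e (T *m e) = T i i by rewrite mdot_delta Te mxE.
have CS x : mdot (col i T) x ^+ 2 <= T i i * mdot x (T *m x).
  rewrite mulrC; apply: quadratic_ge0 => [|t]; first by rewrite -ee pT.
  have := pT (x + t *: e).
  rewrite mulmxDr -scalemxAr !(mdotDl, mdotDr, mdotZl, mdotZr) eT ee.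
  rewrite Te (mdotC x (col i T)); congr (_ <= _); ring.
have [Tii|Tii] := eqVneq (T i i) 0.
  exists r, Y, T; split=> // a b; rewrite ltnS leq_eqVlt => /predU1P[ak|/T0//].
  have -> : a = i by exact: val_inj.
  have /eqP : mdot (col i T) (col i T) = 0.
    apply/eqP; rewrite -sqrf_eq0 eq_le sqr_ge0 andbT.
    by have := CS (col i T); rewrite Tii mul0r.
  rewrite mdotxx_eq0 => /eqP/matrixP/(_ b 0); rewrite !mxE => <-.
  exact: T_sym.
have Tii0 : 0 < T i i by rewrite lt_def Tii -ee pT.
pose s : 'cV[R]_n := (Num.sqrt (T i i))^-1 *: col i T.
have sse : s *m s^T = (T i i)^-1 *: (col i T *m (col i T)^T).
  rewrite /s linearZ/= -scalemxAl -scalemxAr scalerA -expr2 exprVn.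
  by rewrite sqr_sqrtr ?ltW.
exists (r + 1)%N, (row_mx Y s), (T - s *m s^T); split.
- by rewrite tr_row_mx mul_row_col ST -addrA; congr (_ + _);
  rewrite addrC subrK.
- split=> [|x].
    by rewrite linearB/= sT trmx_mul trmxK.
  rewrite mulmxBl mdotBr -mulmxA -[X in _ - X]mdotC mdot_mull.
  rewrite /s linearZ/= -!scalemxAl mdotZl mdotZr.
  have -> : mdot ((col i T)^T *m x) ((col i T)^T *m x) = mdot (col i T) x ^+ 2.
    by rewrite mdotE !big_ord1 /mdot /mxtrace big_ord1 expr2.
  have -> a : (Num.sqrt (T i i))^-1 * ((Num.sqrt (T i i))^-1 * a) = a / T i i.
    by rewrite mulrA -invfM -expr2 sqr_sqrtr ?ltW// mulrC.
  by rewrite subr_ge0 ler_pdivrMr// mulrC.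
- move=> a b; rewrite ltnS leq_eqVlt sse !mxE big_ord1 !mxE.
  move=> /predU1P[ak|ak].
    have -> : a = i by exact: val_inj.
    by rewrite mulrA mulVf// mul1r (T_sym b i) subrr.
  by rewrite !(T0 a)// mul0r mulr0 subrr.
Qed.

(** With [S = Y *m Y^T] the trace is the sum of the quadratic forms of [T] at the columns of [Y].
    This is how matrix inequalities become inequalities of costs. *)
Lemma psd_trace_mul n (S T : 'M[R]_n) : psd S -> psd T -> 0 <= \tr (S *m T).
Proof.
move=> /psd_factor[r [Y ->]] pT.
rewrite -mulmxA mxtrace_mulC -mulmxA.
have := psd_mdot Y pT; rewrite /mdot mxtrace_mulC -!mulmxA mxtrace_mulC.
by rewrite -!mulmxA.
Qed.

Lemma psd_quadratic n (S : 'M[R]_n) c :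
  psd (S - c%:M) ->
  forall r (X : 'M[R]_(n, r)), c * mdot X X <= mdot X (S *m X).
Proof.
move=> pS r X; rewrite -subr_ge0; have := psd_mdot X pS.
by rewrite mulmxBl mul_scalar_mx mdotBr mdotZr.
Qed.

Lemma psd_fnorm n (S : 'M[R]_n) c :
  psd (S - c%:M) -> forall r (X : 'M[R]_(n, r)), c * fnorm X <= fnorm (S *m X).
Proof.
move=> pS r X; have [->|X0] := eqVneq X 0.
  by rewrite mulmx0 !fnorm0 mulr0.
rewrite -(ler_pM2r (_ : 0 < fnorm X)) ?fnorm_gt0//.
rewrite -mulrA -expr2 sqr_fnorm (le_trans (psd_quadratic pS X))//.
by rewrite mulrC mdot_le.
Qed.

Lemma op_bound_fnorm p q r (X : 'M[R]_(p, q)) c (Y : 'M[R]_(q, r)) :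
  0 <= c -> op_bound X c -> fnorm (X *m Y) <= c * fnorm Y.
Proof.
move=> c0 Xc; rewrite -ler_sqr ?nnegrE ?mulr_ge0 ?fnorm_ge0//.
rewrite exprMn !sqr_fnorm mdot_cols (mdot_cols Y) mulr_sumr.
apply: ler_sum => j _; rewrite [col j (X *m Y)]colE -mulmxA -colE -!sqr_fnorm.
by rewrite -exprMn ler_sqr ?nnegrE ?mulr_ge0 ?fnorm_ge0.
Qed.

Lemma op_bound_le p q (X : 'M[R]_(p, q)) c d :
  c <= d -> op_bound X c -> op_bound X d.
Proof. by move=> cd Xc x; rewrite (le_trans (Xc x))// ler_wpM2r ?fnorm_ge0. Qed.

Lemma op_bound_fnormE p q (X : 'M[R]_(p, q)) : op_bound X (fnorm X).
Proof. by move=> x; exact: fnormM. Qed.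

Lemma op_boundD p q (X Y : 'M[R]_(p, q)) c d :
  op_bound X c -> op_bound Y d -> op_bound (X + Y) (c + d).
Proof.
by move=> Xc Yd x; rewrite mulmxDl (le_trans (fnormD _ _))// mulrDl lerD.
Qed.

Lemma op_boundN p q (X : 'M[R]_(p, q)) c : op_bound X c -> op_bound (- X) c.
Proof. by move=> Xc x; rewrite mulNmx fnormN. Qed.

Lemma op_boundM p q r (X : 'M[R]_(p, q)) (Y : 'M[R]_(q, r)) c d :
  0 <= c -> op_bound X c -> op_bound Y d -> op_bound (X *m Y) (c * d).
Proof.
move=> c0 Xc Yd x; rewrite -mulmxA (le_trans (Xc _))// -mulrA ler_wpM2l//.
Qed.

(** |X^T x|^2 = <x, X X^T x> <= |x| c |X^T x|; divide by |X^T x|. *)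
Lemma op_bound_tr p q (X : 'M[R]_(p, q)) c :
  0 <= c -> op_bound X c -> op_bound X^T c.
Proof.
move=> c0 Xc x; have [->|x0] := eqVneq (X^T *m x) 0.
  by rewrite fnorm0 mulr_ge0 ?fnorm_ge0.
rewrite -(ler_pM2l (_ : 0 < fnorm (X^T *m x))) ?fnorm_gt0//.
rewrite -expr2 sqr_fnorm mdot_mull trmxK mdotC (le_trans (mdot_le _ _))//.
by rewrite mulrA [X in _ <= X * _]mulrC ler_wpM2r ?fnorm_ge0.
Qed.

Lemma op_bound_conj p q (X : 'M[R]_(p, q)) (S : 'M[R]_q) c d :
  0 <= c -> 0 <= d -> op_bound X c -> op_bound S d ->
  op_bound (X *m S *m X^T) (c ^+ 2 * d).
Proof.
move=> c0 d0 Xc Sd; rewrite expr2 mulrAC.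
apply: op_boundM; first exact: mulr_ge0.
  exact: op_boundM.
exact: op_bound_tr.
Qed.

(** If [S = Y *m Y^T], its trace is the squared Frobenius norm of [Y]. The trace replaces the
    largest eigenvalue because it is linear and so comparable with the cost. *)
Lemma psd_op_bound n (S : 'M[R]_n) : psd S -> op_bound S (\tr S).
Proof.
move=> /psd_factor[r [Y ->]] x; rewrite -mulmxA (le_trans (fnormM _ _))//.
have -> : \tr (Y *m Y^T) = fnorm Y ^+ 2 by rewrite sqr_fnorm /mdot mxtrace_mulC.
rewrite expr2 -mulrA ler_wpM2l ?fnorm_ge0// (le_trans (fnormM _ _))//.
by rewrite fnorm_tr.
Qed.

Lemma psd_trace n (S : 'M[R]_n) : psd S -> 0 <= \tr S.
Proof.
by move=> pS; rewrite -[S]mulmx1; apply: psd_trace_mul => //; exact: psd_scalar.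
Qed.

End PositiveSemidefinite.

(** * Extreme singular values by Rayleigh quotients *)

Section SingularValues.
Context {R : realType}.
Local Open Scope classical_set_scope.

(* The supremum l of the Rayleigh quotients makes l - S positive semidefinite,
   so l - S = Y Y^T; if it were invertible, <x, (l - S) x> = |Y^T x|^2 would be
   bounded below on the unit sphere and l could be lowered. *)
Lemma sym_max_eigenvalue n (S : 'M[R]_n) : (0 < n)%N -> S^T = S ->
  exists l x, [/\ x != 0 :> 'cV_n, S *m x = l *: x & psd (l%:M - S)].
Proof.
move=> n0 sS.
pose B : set R :=
  [set r | exists2 x : 'cV[R]_n, mdot x x = 1 & r = mdot x (S *m x)].
have B0 : B !=set0.
  pose e : 'cV[R]_n := delta_mx (Ordinal n0) 0.
  exists (mdot e (S *m e)), e => //.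
  by rewrite mdot_delta mxE !eqxx.
have ubB : ubound B (fnorm S).
  move=> _ [x x1 ->]; have x1' : fnorm x = 1 by rewrite /fnorm x1 sqrtr1.
  rewrite (le_trans (mdot_le _ _))// x1' mul1r.
  by rewrite (le_trans (fnormM _ _))// x1' mulr1.
have hB : has_sup B by split=> //; exists (fnorm S).
have lS : psd ((sup B)%:M - S).
  split=> [|x]; first by rewrite linearB/= tr_scalar_mx sS.
  rewrite mulmxBl mul_scalar_mx mdotBr mdotZr subr_ge0.
  have [->|x0] := eqVneq x 0; first by rewrite !mdot0l mulr0.
  have xx0 : 0 < mdot x x by rewrite lt_def mdotxx_eq0 x0 mdotxx_ge0.
  have : B (mdot x (S *m x) / mdot x x).
    exists ((fnorm x)^-1 *: x).
      rewrite mdotZl mdotZr mulrA -expr2 exprVn sqr_fnorm mulVf ?gt_eqF//.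
    rewrite -scalemxAr mdotZl mdotZr mulrA -expr2 exprVn sqr_fnorm mulrC//.
  by move/(sup_upper_bound hB); rewrite ler_pdivrMr.
case: (boolP ((sup B)%:M - S \in unitmx)) => [uS|]; last first.
  rewrite -row_free_unit -kermx_eq0 => /rowV0Pn[v vk v0].
  exists (sup B), v^T; split=> //; first by rewrite trmx_eq0.
  move/sub_kermxP : vk => /(congr1 trmx); rewrite trmx_mul trmx0 linearB/=.
  rewrite tr_scalar_mx sS mulmxBl mul_scalar_mx => /eqP.
  by rewrite subr_eq0 => /eqP.
exfalso; have [r [Y SY]] := psd_factor lS.
(* [Z] is a left inverse of [Y^T], so |Y^T x| >= 1 / |Z| on the unit sphere; hence the amount
   [fnorm Z ^- 2] by which the supremum is lowered below. *)
pose Z := invmx ((sup B)%:M - S) *m Y.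
have ZY : Z *m Y^T = 1%:M by rewrite /Z -mulmxA -SY mulVmx.
have Z0 : 0 < fnorm Z.
  rewrite fnorm_gt0; apply/eqP => Z0; move: ZY; rewrite Z0 mul0mx.
  move/matrixP/(_ (Ordinal n0) (Ordinal n0)); rewrite !mxE eqxx => /eqP.
  by rewrite eq_sym oner_eq0.
have [_ [x x1 ->]] : exists2 r, B r & sup B - (fnorm Z ^- 2) < r.
  by apply: sup_adherent; rewrite // invr_gt0 exprn_gt0.
apply/negP; rewrite -leNgt.
have : mdot x (((sup B)%:M - S) *m x) = fnorm (Y^T *m x) ^+ 2.
  by rewrite SY -mulmxA mdotC mdot_mull sqr_fnorm.
rewrite mulmxBl mul_scalar_mx mdotBr mdotZr x1 mulr1 => e.
rewrite lerBrDr -lerBrDl e -(ler_pM2l (_ : 0 < fnorm Z ^+ 2)) ?exprn_gt0//.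
rewrite mulfV ?gt_eqF ?exprn_gt0// -exprMn -[leLHS](expr1n _ 2).
rewrite ler_sqr ?nnegrE ?mulr_ge0 ?fnorm_ge0//.
rewrite (le_trans _ (fnormM _ _))// mulmxA ZY mul1mx /fnorm x1 sqrtr1//.
Qed.

Lemma sym_min_eigenvalue n (S : 'M[R]_n) : (0 < n)%N -> S^T = S ->
  exists l x, [/\ x != 0 :> 'cV_n, S *m x = l *: x & psd (S - l%:M)].
Proof.
move=> n0 sS.
have [|l [x [x0 Sx pS]]] := @sym_max_eigenvalue n (- S) n0.
  by rewrite linearN/= sS.
exists (- l), x; split=> //; first by rewrite scaleNr -Sx mulNmx opprK.
by move: pS; rewrite opprK addrC raddfN/= opprK.
Qed.

Lemma singular_valueP p q (X : 'M[R]_(p, q)) s : singular_value X s <->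
  0 <= s /\ exists2 x : 'cV_q, x != 0 & X^T *m X *m x = s ^+ 2 *: x.
Proof.
have sX : (X^T *m X)^T = X^T *m X by rewrite trmx_mul trmxK.
split=> -[s0 h]; split=> //.
  move/eigenvalueP : h => [v vX v0]; exists v^T; first by rewrite trmx_eq0.
  by rewrite -sX -trmx_mul vX linearZ.
move: h => [x x0 xX]; apply/eigenvalueP; exists x^T; last by rewrite trmx_eq0.
by rewrite -sX -trmx_mul xX linearZ.
Qed.

Lemma singular_value_fnorm p q (X : 'M[R]_(p, q)) s : singular_value X s ->
  0 <= s /\ exists2 x : 'cV_q, x != 0 & fnorm (X *m x) = s * fnorm x.
Proof.
move=> /singular_valueP[s0 [x x0 xX]]; split=> //; exists x => //.
apply/eqP; rewrite -(@eqrXn2 _ 2) ?mulr_ge0 ?fnorm_ge0//.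
by rewrite exprMn !sqr_fnorm mdot_mull mulmxA xX mdotZr.
Qed.

Lemma eigen_singular_value n (S : 'M[R]_n) l (x : 'cV_n) : 0 <= l -> S^T = S ->
  x != 0 -> S *m x = l *: x -> singular_value S l.
Proof.
move=> l0 sS x0 Sx; apply/singular_valueP; split=> //; exists x => //.
by rewrite sS -mulmxA Sx -scalemxAr Sx scalerA.
Qed.

Lemma max_singular_value p q (X : 'M[R]_(p, q)) : (0 < q)%N ->
  exists2 s, singular_value X s & op_bound X s.
Proof.
move=> q0; have pX : psd (X^T *m X) by rewrite -{2}(trmxK X); exact: psd_gram.
have [l [x [x0 Xx lX]]] := sym_max_eigenvalue q0 pX.1.
have xx0 : 0 < mdot x x by rewrite lt_def mdotxx_eq0 x0 mdotxx_ge0.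
have l0 : 0 <= l.
  by rewrite -(pmulr_lge0 _ xx0) -mdotZr -Xx; exact: pX.2.
exists (Num.sqrt l).
  apply/singular_valueP; split; first exact: sqrtr_ge0.
  by exists x; rewrite ?sqr_sqrtr.
move=> y; rewrite -ler_sqr ?nnegrE ?mulr_ge0 ?fnorm_ge0 ?sqrtr_ge0//.
rewrite exprMn !sqr_fnorm sqr_sqrtr// mdot_mull mulmxA -subr_ge0.
by have := lX.2 y; rewrite mulmxBl mul_scalar_mx mdotBr mdotZr.
Qed.

Lemma singular_value_op_bound p q (X : 'M[R]_(p, q)) c :
  op_bound X c -> ubound (singular_value X) c.
Proof.
move=> Xc s /singular_value_fnorm[_ [x x0 Xx]].
by rewrite -(ler_pM2r (_ : 0 < fnorm x)) ?fnorm_gt0// -Xx.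
Qed.

Lemma sigma_max_singular p q (X : 'M[R]_(p, q)) : (0 < q)%N ->
  singular_value X (sigma_max X) /\ op_bound X (sigma_max X).
Proof.
move=> q0; have [s Xs sX] := max_singular_value X q0.
suff -> : sigma_max X = s by [].
apply/le_anti/andP; split.
  by apply: ge_sup; [exists s|exact: singular_value_op_bound].
by apply: ub_le_sup => //; exists s; exact: singular_value_op_bound.
Qed.

Lemma sigma_max_ge0 p q (X : 'M[R]_(p, q)) : (0 < q)%N -> 0 <= sigma_max X.
Proof. by move=> /(sigma_max_singular X)[[]]. Qed.

Lemma sigma_max_op_bound p q (X : 'M[R]_(p, q)) :
  (0 < q)%N -> op_bound X (sigma_max X).
Proof. by move=> /(sigma_max_singular X)[]. Qed.

Lemma op_bound_quadratic n (S : 'M[R]_n) c r (X : 'M[R]_(n, r)) :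
  0 <= c -> op_bound S c -> mdot X (S *m X) <= c * mdot X X.
Proof.
move=> c0 Sc; rewrite (le_trans (mdot_le _ _))//.
rewrite -sqr_fnorm expr2 mulrCA ler_wpM2l ?fnorm_ge0//.
exact: op_bound_fnorm.
Qed.

(** The least eigenvalue of a positive semidefinite [S] is itself a singular value, and |S y| >= l
    |y| keeps every other one above it. *)
Lemma sigma_minP n (S : 'M[R]_n) : (0 < n)%N -> psd S ->
  psd (S - (sigma_min S)%:M) /\ (posdef S -> 0 < sigma_min S).
Proof.
move=> n0 pS; have [l [x [x0 Sx lS]]] := sym_min_eigenvalue n0 pS.1.
have xx0 : 0 < mdot x x by rewrite lt_def mdotxx_eq0 x0 mdotxx_ge0.
have l0 : 0 <= l by rewrite -(pmulr_lge0 _ xx0) -mdotZr -Sx; exact: pS.2.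
have Sl := eigen_singular_value l0 pS.1 x0 Sx.
have -> : sigma_min S = l.
  apply/le_anti/andP; split; first by apply: ge_inf => //; exists 0 => ? [].
  apply: lb_le_inf; first by exists l.
  move=> s /singular_value_fnorm[_ [y y0 Sy]].
  by rewrite -(ler_pM2r (_ : 0 < fnorm y)) ?fnorm_gt0// -Sy; exact: psd_fnorm.
split=> // /posdefE[_ /(_ x x0)].
by rewrite Sx mdotZr pmulr_lgt0.
Qed.

Lemma psd_sigma_min n (S : 'M[R]_n) : (0 < n)%N -> psd S ->
  psd (S - (sigma_min S)%:M).
Proof. by move=> n0 /(sigma_minP n0)[]. Qed.

Lemma sigma_min_gt0 n (S : 'M[R]_n) : (0 < n)%N -> posdef S -> 0 < sigma_min S.
Proof. by move=> n0 pS; have [_ ->] := sigma_minP n0 (posdef_psd pS). Qed.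

End SingularValues.

(** * Error covariance and cost-to-go *)

Section ErrorCovariance.
Context {R : realType} {N m : nat}.
Variables (A : 'M[R]_N) (C : 'M[R]_(m, N)).
Variables (Q : nat -> 'M[R]_N) (Rv : nat -> 'M[R]_m).
Variables (P0 Sg : 'M[R]_N).
Implicit Types (k : nat -> 'M[R]_(N, m)) (L D E : 'M[R]_(N, m)) (P : 'M[R]_N).

Definition predict t P : 'M[R]_N := A *m P *m A^T + Q t.

Definition innov t P : 'M[R]_m := C *m predict t P *m C^T + Rv t.+1.

(** Joseph form of the Kalman covariance update: correct for every gain [L], not only for the
    optimal one, and visibly positive semidefinite. *)
Definition cov_step L t P : 'M[R]_N :=
  (1%:M - L *m C) *m predict t P *m (1%:M - L *m C)^T + L *m Rv t.+1 *m L^T.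

Fixpoint err_cov k t : 'M[R]_N :=
  if t is s.+1 then cov_step (k s) s (err_cov k s) else P0.

(* Half the gradient of [tr (cov_step L t P)] with respect to L. *)
Definition half_grad L t P : 'M[R]_(N, m) :=
  L *m innov t P - predict t P *m C^T.

Definition err_dyn L : 'M[R]_N := (1%:M - L *m C) *m A.

(* Weight of the error at time t in the cost of the times t, ..., t + n. *)
Fixpoint cost_to_go k n t : 'M[R]_N :=
  if n is n'.+1 then
    Sg + (err_dyn (k t))^T *m cost_to_go k n' t.+1 *m err_dyn (k t)
  else Sg.

Definition total_cost k M : R := \sum_(t < M) \tr (err_cov k t.+1 *m Sg).

Arguments predict : simpl never.
Arguments innov : simpl never.
Arguments cov_step : simpl never.
Arguments half_grad : simpl never.

Hypotheses (sP0 : psd P0) (sSg : psd Sg).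
Hypotheses (sQ : forall t, psd (Q t)) (sR : forall t, psd (Rv t)).

Lemma psd_predict t P : psd P -> psd (predict t P).
Proof. by move=> pP; apply: psdD => //; exact: psd_conj. Qed.

Lemma psd_innov t P : psd P -> psd (innov t P).
Proof. by move=> pP; apply: psdD => //; exact/psd_conj/psd_predict. Qed.

Lemma psd_err_cov k t : psd (err_cov k t).
Proof.
elim: t => [//|t IH] /=; apply: psdD; last exact: psd_conj.
exact/psd_conj/psd_predict.
Qed.

Lemma psd_cost_to_go k n t : psd (cost_to_go k n t).
Proof.
elim: n t => [//|n IH] t /=; apply: psdD => //; exact: psd_congr.
Qed.

Lemma cost_to_go_ge k n t c : psd (Sg - c%:M) -> psd (cost_to_go k n t - c%:M).
Proof.
case: n => [//|n] pc /=; rewrite addrAC; apply: psdD => //.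
exact/psd_congr/psd_cost_to_go.
Qed.

Lemma cov_stepE L t P : cov_step L t P =
  predict t P - L *m (C *m predict t P) - predict t P *m C^T *m L^T
  + L *m innov t P *m L^T.
Proof.
rewrite /cov_step /innov; move: (predict t P) (Rv t.+1) => Y V.
rewrite linearB/= trmx1 trmx_mul !(mulmxBl, mulmxBr, mulmxDl, mulmxDr).
rewrite !(mul1mx, mulmx1) !mulmxA !addrA; congr (_ + _).
by apply/matrixP => u v; rewrite !mulNmx !mxE; ring.
Qed.

(** The update is quadratic in the gain, so its second order expansion is exact. Symmetry of
    [predict] and [innov] makes the two linear terms transposes of each other. *)
Lemma cov_step_diff L D t P : psd P ->
  cov_step (L + D) t P - cov_step L t P =
  D *m (half_grad L t P)^T + half_grad L t P *m D^T + D *m innov t P *m D^T.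
Proof.
move=> pP; rewrite !cov_stepE /half_grad.
move: (predict t P) (innov t P) (psd_predict t pP).1 (psd_innov t pP).1.
move=> Y W sY sW.
have trD p q (X Z : 'M[R]_(p, q)) : (X + Z)^T = X^T + Z^T by rewrite linearD.
have trN p q (X : 'M[R]_(p, q)) : (- X)^T = - X^T by rewrite linearN.
rewrite !(trD, trN) !trmx_mul trmxK sY sW.
rewrite !(mulmxBl, mulmxBr, mulmxDl, mulmxDr, mulNmx, mulmxN) !mulmxA.
apply/matrixP => u v; rewrite !mxE; ring.
Qed.

Lemma trace_cov_step_diff L D t P S : psd P -> S^T = S ->
  \tr ((cov_step (L + D) t P - cov_step L t P) *m S) =
  2 * mdot D (S *m half_grad L t P) + mdot D (S *m D *m innov t P).
Proof.
move=> pP sS; rewrite cov_step_diff//.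
move: (half_grad L t P) (innov t P) => E W; rewrite !mulmxDl !linearD/=.
have -> : \tr (E *m D^T *m S) = mdot D (S *m E).
  by rewrite -mulmxA mxtrace_mulC /mdot -mulmxA.
have -> : \tr (D *m E^T *m S) = mdot D (S *m E).
  rewrite -mxtrace_tr !trmx_mul trmxK sS mulmxA mxtrace_mulC.
  by rewrite /mdot.
have -> : \tr (D *m W *m D^T *m S) = mdot D (S *m D *m W).
  by rewrite -[_ *m S]mulmxA mxtrace_mulC /mdot !mulmxA mxtrace_mulC !mulmxA.
ring.
Qed.

(** For a fixed gain the noise terms cancel, and a covariance gap is transported by the closed loop
    matrix alone; the adjoint transport builds [cost_to_go]. *)
Lemma cov_step_affine L t P P' :
  cov_step L t P' - cov_step L t P = err_dyn L *m (P' - P) *m (err_dyn L)^T.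
Proof.
rewrite /cov_step opprD addrACA subrr addr0 -mulmxBl -mulmxBr /predict.
rewrite opprD addrACA subrr addr0 -mulmxBl -mulmxBr /err_dyn trmx_mul.
by rewrite !mulmxA.
Qed.

Lemma err_dyn_diff L D : err_dyn (L - D) - err_dyn L = D *m (C *m A).
Proof.
rewrite /err_dyn -mulmxBl mulmxA; congr (_ *m _); rewrite mulmxBl.
apply/matrixP => i j; rewrite !mxE; ring.
Qed.

(** Induction on the horizon. The gap present at time [t] is charged with all later costs under
    [k']; the weight is [cost_to_go] minus [Sg] because the sum on the left starts at time t + 1. *)
Lemma cost_diff_from k k' n t :
  \sum_(i < n) \tr ((err_cov k' (t + i).+1 - err_cov k (t + i).+1) *m Sg) =
  \tr ((err_cov k' t - err_cov k t) *m (cost_to_go k' n t - Sg)) +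
  \sum_(i < n)
    \tr ((cov_step (k' (t + i)%N) (t + i) (err_cov k (t + i))
          - cov_step (k (t + i)%N) (t + i) (err_cov k (t + i)))
         *m cost_to_go k' (n - i.+1) (t + i).+1).
Proof.
elim: n t => [|n IH] t; first by rewrite !big_ord0 subrr mulmx0 mxtrace0 addr0.
rewrite !big_ord_recl !addn0 subSS subn0.
under eq_bigr do rewrite lift0 addnS -addSn.
rewrite IH [X in _ + X = _]addrC.
under [in RHS]eq_bigr do rewrite lift0 addnS -addSn subSS.
rewrite addrCA [RHS]addrA [RHS]addrC; congr (_ + _).
rewrite -mxtraceD -mulmxDr [Sg + _]addrC subrK.
(* The intermediate covariance makes one step with [k'] from the covariance of [k]: it separates the
   inherited gap, affine in the covariance, from the effect of changing the gain at time [t]. *)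
rewrite -[in LHS](subrK (cov_step (k' t) t (err_cov k t)) (err_cov k' t.+1)).
rewrite -addrA mulmxDl mxtraceD; congr (_ + _).
rewrite cov_step_affine /= [Sg + _]addrC addrK.
by rewrite -mulmxA mxtrace_mulC !mulmxA mxtrace_mulC !mulmxA.
Qed.

Lemma total_cost_diff k k' M : total_cost k' M - total_cost k M =
  \sum_(t < M)
    (2 * mdot (k' t - k t) (cost_to_go k' (M - t.+1) t.+1
                            *m half_grad (k t) t (err_cov k t))
     + mdot (k' t - k t) (cost_to_go k' (M - t.+1) t.+1
                          *m (k' t - k t) *m innov t (err_cov k t))).
Proof.
rewrite -sumrB; under eq_bigr do rewrite -raddfB/= -mulmxBl.
have := cost_diff_from k k' M 0; rewrite subrr mul0mx mxtrace0 add0r => ->.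
apply: eq_bigr => t _; rewrite add0n.
rewrite -{1}(addrNK (k t) (k' t)) [X in cov_step X](addrC).
rewrite trace_cov_step_diff//.
  exact: psd_err_cov.
by have [] := psd_cost_to_go k' (M - t.+1) t.+1.
Qed.

Lemma trace_cov_ge0 k t : 0 <= \tr (err_cov k t *m Sg).
Proof. exact/psd_trace_mul/sSg/psd_err_cov. Qed.

Lemma total_cost_ge0 k M : 0 <= total_cost k M.
Proof. by apply: sumr_ge0 => t _; exact: trace_cov_ge0. Qed.

Lemma trace_cov_le_total k M t : (t < M)%N ->
  \tr (err_cov k t.+1 *m Sg) <= total_cost k M.
Proof.
move=> tM; rewrite /total_cost (bigD1 (Ordinal tM))// lerDl.
by apply: sumr_ge0 => i _; exact: (trace_cov_ge0 k i.+1).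
Qed.

(** The left side is the cost from time [t] on with all later noise removed, and noise only enlarges
    covariances. *)
Lemma trace_cost_to_go_le k n t :
  \tr (err_cov k t *m cost_to_go k n t) <=
  \sum_(i < n.+1) \tr (err_cov k (t + i) *m Sg).
Proof.
elim: n t => [|n IH] t; first by rewrite big_ord1 addn0.
rewrite big_ord_recl addn0 /= mulmxDr mxtraceD lerD2l.
under eq_bigr do rewrite /bump/= addnS -addSn.
apply: le_trans (IH t.+1); rewrite -subr_ge0.
set S := cost_to_go k n t.+1.
have -> : \tr (err_cov k t *m ((err_dyn (k t))^T *m S *m err_dyn (k t))) =
    \tr (err_dyn (k t) *m err_cov k t *m (err_dyn (k t))^T *m S).
  by rewrite mulmxA mxtrace_mulC !mulmxA.
rewrite -raddfB/= -mulmxBl; apply: psd_trace_mul; last exact: psd_cost_to_go.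
(* F P F^T is the update of P minus the update of 0, so the excess is the update of 0, the pure
   noise contribution. *)
have := cov_step_affine (k t) t 0 (err_cov k t); rewrite subr0 => <-.
rewrite opprB addrCA subrr addr0 /cov_step; apply: psdD; last exact: psd_conj.
exact/psd_conj/psd_predict/psd0.
Qed.

Lemma trace_cost_to_go_total k M s : (s < M)%N ->
  \tr (err_cov k s.+1 *m cost_to_go k (M - s.+1) s.+1) <= total_cost k M.
Proof.
move=> sM; apply: le_trans (trace_cost_to_go_le _ _ _) _.
(* The cost counts the times 1, ..., M; those from s + 1 on form a tail of j + 1 terms. *)
have [j ->] : exists j, M = (s + j.+1)%N.
  by exists (M - s.+1)%N; rewrite addnS -addSn subnKC.
have -> : (s + j.+1 - s.+1)%N = j by rewrite addnS subSS addKn.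
rewrite /total_cost big_split_ord/= lerDr.
by apply: sumr_ge0 => i _; exact: (trace_cov_ge0 k i.+1).
Qed.

(** Origin of [calB]. Write S_{s+1} = Sg + F^T S F with F = (1 - K C) A and S = S_{s+2}. Then q
    tr(F^T S F) <= tr(F^T S F A^-1 Q A^-T); here A cancels and leaves the noise part (1 - K C) Q (1
    - K C)^T of P_{s+2}, weighted by S. At the last step the weight is [Sg] alone. *)
Lemma trace_cost_to_go_bound k M q s : A \in unitmx -> 0 < q ->
  (forall t, (t < M)%N -> psd (invmx A *m Q t *m (invmx A)^T - q%:M)) ->
  (s < M)%N ->
  \tr (cost_to_go k (M - s.+1) s.+1) <= total_cost k M / q + \tr Sg.
Proof.
move=> uA q0 Qq sM; case n_def : (M - s.+1)%N => [|n] /=.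
  by rewrite lerDr divr_ge0 ?total_cost_ge0 ?ltW.
have s1M : (s.+1 < M)%N by rewrite -subn_gt0 n_def.
rewrite mxtraceD addrC lerD2r ler_pdivlMr//.
have nE : n = (M - s.+2)%N by rewrite subnS n_def.
rewrite nE; apply: le_trans (trace_cost_to_go_total k s1M).
set S := cost_to_go k _ _.
set F := err_dyn (k s.+1).
have pS := psd_cost_to_go k (M - s.+2) s.+2.
have := psd_trace_mul (psd_congr F pS) (Qq _ s1M).
rewrite mulmxBr mul_mx_scalar linearB/= linearZ/= subr_ge0 mulrC.
move=> /le_trans; apply; rewrite -/S.
have -> : \tr (F^T *m S *m F *m (invmx A *m Q s.+1 *m (invmx A)^T)) =
    \tr ((1%:M - k s.+1 *m C) *m Q s.+1 *m (1%:M - k s.+1 *m C)^T *m S).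
  rewrite /F /err_dyn trmx_mul !mulmxA mulmxK// mxtrace_mulC !mulmxA.
  rewrite -trmx_mul mulmxV// trmx1 mul1mx -!mulmxA mxtrace_mulC.
  by rewrite -!mulmxA mxtrace_mulC !mulmxA.
rewrite -subr_ge0 -raddfB/= -mulmxBl; apply: psd_trace_mul; last first.
  exact: psd_cost_to_go.
rewrite -[cov_step (k s) s _]/(err_cov k s.+1).
move: (err_cov k s.+1) (psd_err_cov k s.+1) => P pP.
rewrite /cov_step /predict mulmxDr mulmxDl addrAC addrK; apply: psdD.
  exact/psd_conj/psd_conj.
exact: psd_conj.
Qed.

Lemma eq_cost_to_go k k' n t : (forall s, (t <= s)%N -> k s = k' s) ->
  cost_to_go k n t = cost_to_go k' n t.
Proof.
elim: n t => [//|n IH] t kk' /=; rewrite kk'// IH// => s /ltnW; exact: kk'.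
Qed.

Lemma eq_total_cost k k' M : (forall t, (t < M)%N -> k t = k' t) ->
  total_cost k M = total_cost k' M.
Proof.
move=> kk'; apply: eq_bigr => t _; congr (\tr (_ *m _)).
have := ltn_ord t; elim: (nat_of_ord t) => [|s IH] sM /=; first by rewrite kk'.
have /= <- := IH (ltnW sM); by rewrite (kk' s.+1).
Qed.

Lemma mdot_innov_ge n (V W : 'M[R]_m) (S : 'M[R]_n) (D : 'M[R]_(n, m)) :
  psd S -> psd (V - W) -> mdot D (S *m D *m W) <= mdot D (S *m D *m V).
Proof.
move=> pS pVW; rewrite -subr_ge0 -mdotBr -mulmxBr /mdot !mulmxA.
apply: psd_trace_mul => //.
exact: psd_congr.
Qed.

Lemma mdot_scalar_mulr n c (X Y : 'M[R]_(n, m)) :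
  mdot X (Y *m c%:M) = c * mdot X Y.
Proof. by rewrite mul_mx_scalar mdotZr. Qed.

(** * Domination, descent and perturbation of the weights *)

Section Gradient.
Variable M : nat.

Definition next_weight k t := cost_to_go k (M - t.+1) t.+1.
Definition residual k t := half_grad (k t) t (err_cov k t).
(** The squared Frobenius norm of the whole gradient, whose block at [t] is twice
    [next_weight k t *m residual k t]. *)
Definition grad_sqr k := \sum_(t < M) 4 * mdot (next_weight k t *m residual k t)
  (next_weight k t *m residual k t).

Lemma psd_next_weight k t : psd (next_weight k t).
Proof. exact: psd_cost_to_go. Qed.

(** Termwise, with W >= lo: 2 <D, S'E> + <D, S'D W> >= 2 <D, S'E> + lo <D, S'D> >= - <E, S'E> / lo.
    Then S' <= B, and |E| <= |S E| / mu brings in the gradient. Since S' belongs to [k'], so does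
    the bound [B]. *)
Lemma gradient_domination k k' lo mu B :
  0 < lo -> (forall t, (t < M)%N -> psd (Rv t.+1 - lo%:M)) ->
  0 < mu -> psd (Sg - mu%:M) ->
  (forall t, (t < M)%N -> \tr (next_weight k' t) <= B) ->
  total_cost k M - total_cost k' M <= B / (4 * lo * mu ^+ 2) * grad_sqr k.
Proof.
move=> lo0 Rlo mu0 Smu SB; rewrite -opprB lerNl total_cost_diff -mulrN.
rewrite /grad_sqr -sumrN mulr_sumr; apply: ler_sum => t _.
have tM := ltn_ord t; rewrite -/(next_weight k' t) -/(residual k t).
set S' := next_weight k' t; set S := next_weight k t; set E := residual k t.
set D := k' t - k t; set W := innov _ _.
have pS' : psd S' := psd_next_weight k' t.
have Wlo : psd (W - lo%:M).
  rewrite /W /innov -addrA; apply: psdD; last exact: Rlo.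
  exact/psd_conj/psd_predict/psd_err_cov.
have := mdot_innov_ge D pS' Wlo; rewrite mdot_scalar_mulr => h1.
have h2 := psd_mdotD lo D E pS'.
have B0 : 0 <= B by apply: le_trans (SB t tM); exact/psd_trace.
have h3 : mdot E (S' *m E) <= B * mdot E E.
  apply: op_bound_quadratic => //; apply: op_bound_le (SB t tM) _.
  exact: psd_op_bound.
have h4 : mu ^+ 2 * mdot E E <= mdot (S *m E) (S *m E).
  rewrite -!sqr_fnorm -exprMn ler_sqr ?nnegrE ?mulr_ge0 ?fnorm_ge0 ?(ltW mu0)//.
  by apply: psd_fnorm; exact: cost_to_go_ge.
set x := mdot (S *m E) _ in h4 *; set y := mdot E E in h3 h4 *.
set u := mdot D (S' *m E) in h2 *; set v := mdot D (S' *m D) in h1 h2 *.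
set z := mdot E (S' *m E) in h2 h3 *; set o := mdot D _ in h1 *.
have h5 : - (B / lo * y) <= 2 * u + lo * v.
  rewrite -(ler_pM2l lo0); have -> : lo * - (B / lo * y) = - (B * y).
    by field; rewrite gt_eqF.
  lra.
have h6 : B / lo * y <= B / (4 * lo * mu ^+ 2) * (4 * x).
  have -> : B / (4 * lo * mu ^+ 2) * (4 * x) = B / lo * (x / mu ^+ 2).
    by field; rewrite !gt_eqF.
  rewrite ler_wpM2l ?divr_ge0 ?(ltW lo0)// ler_pdivlMr ?exprn_gt0//.
  by rewrite mulrC.
rewrite mulrN; lra.
Qed.

Lemma residual_le_gap k k' w mu :
  (forall k'', total_cost k' M <= total_cost k'' M) ->
  0 < w -> (forall t, (t < M)%N -> psd (w%:M - innov t (err_cov k t))) ->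
  0 < mu -> psd (Sg - mu%:M) ->
  \sum_(t < M) mdot (residual k t) (residual k t) <=
  w / mu * (total_cost k M - total_cost k' M).
Proof.
move=> k'_min w0 Ww mu0 Smu.
(* The trial step follows the residual E rather than the gradient S E: S' then occurs only in forms
   in E, so the lower bound S' >= mu suffices and S' need not be compared with S. *)
pose l t := k t - w^-1 *: residual k t.
have lk t : l t - k t = - w^-1 *: residual k t.
  by rewrite /l addrAC subrr add0r scaleNr.
rewrite -(ler_pM2l (_ : 0 < mu / w)) ?divr_gt0//.
rewrite mulrA -[w / mu]invf_div mulfV ?mul1r ?gt_eqF ?divr_gt0//.
apply: (@le_trans _ _ (total_cost k M - total_cost l M)); last first.
  by rewrite lerD2l lerN2.
rewrite -[leRHS]opprB total_cost_diff -sumrN mulr_sumr; apply: ler_sum => t _.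
have tM := ltn_ord t; rewrite -/(next_weight l t) lk -/(residual k t).
set E := residual k t; set S' := next_weight l t; set W := innov _ _.
have pS' : psd S' := psd_next_weight l t.
have := mdot_innov_ge E pS' (Ww t tM); rewrite mdot_scalar_mulr -/W => h1.
rewrite -scalemxAr -scalemxAl !mdotZl mdotZr.
have h2 : mu * mdot E E <= mdot E (S' *m E).
  by apply: psd_quadratic; exact: cost_to_go_ge.
set x := mdot E E in h2 *; set y := mdot E (S' *m E) in h1 h2 *.
set z := mdot E _ in h1 *.
have -> : mu / w * x = w^-1 * (mu * x) by rewrite mulrAC mulrC.
have -> : - (2 * (- w^-1 * y) + - w^-1 * (- w^-1 * z)) =
   w^-1 * (2 * y - w^-1 * z) by ring.
rewrite ler_pM2l ?invr_gt0//.
have : w^-1 * z <= y by rewrite mulrC ler_pdivrMr// mulrC.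
lra.
Qed.

(** Put G = S E. In min(1, mu) / 2 the mu gives |(S' - S) E| <= |G| / 2, so at least half of the
    linear gain survives; the 1 gives S' <= 1/2 + B, the factor in [c4], so the quadratic term costs
    at most |G|^2. What remains is eta (-4 + 2 + 1) |G|^2. *)
Lemma descent_step k eta w mu B :
  0 < w -> (forall t, (t < M)%N -> psd (w%:M - innov t (err_cov k t))) ->
  0 < mu -> psd (Sg - mu%:M) -> 0 < eta ->
  (forall t, (t < M)%N -> \tr (next_weight k t) <= B) ->
  eta * (4 * w * (2^-1 + B)) <= 1 ->
  let k' t := k t - (2 * eta) *: (next_weight k t *m residual k t) in
  (forall t, (t < M)%N ->
     op_bound (next_weight k' t - next_weight k t) (Num.min 1 mu / 2)) ->
  total_cost k' M <= total_cost k M - eta / 4 * grad_sqr k.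
Proof.
move=> w0 Ww mu0 Smu eta0 SB etaw k' SS'.
rewrite addrC -lerBlDr total_cost_diff mulr_sumr -sumrN; apply: ler_sum => t _.
have tM := ltn_ord t; rewrite -/(next_weight k' t) -/(residual k t).
have -> : k' t - k t = - (2 * eta) *: (next_weight k t *m residual k t).
  by rewrite /k' addrAC subrr add0r scaleNr.
set E := residual k t; set S' := next_weight k' t; set S := next_weight k t.
set W := innov _ _; set G := S *m E.
have pS' : psd S' := psd_next_weight k' t.
have h1 : mdot G (S' *m G *m W) <= w * mdot G (S' *m G).
  by rewrite -mdot_scalar_mulr; apply: mdot_innov_ge => //; exact: Ww.
have min1 : Num.min 1 mu / 2 <= 2^-1.
  by rewrite ler_pdivrMr// mulVf// ge_min lexx.
have minmu : Num.min 1 mu / 2 <= mu / 2.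
  by rewrite ler_pM2r ?invr_gt0// ge_min lexx orbT.
have min0 : 0 <= Num.min 1 mu / 2 by rewrite divr_ge0// le_min ler01 ltW.
have B0 : 0 <= B by apply: le_trans (SB t tM); exact/psd_trace/psd_next_weight.
have h2 : mdot G (S' *m G) <= (2^-1 + B) * mdot G G.
  apply: op_bound_quadratic; first by rewrite addr_ge0// invr_ge0.
  rewrite -(subrK S S'); apply: op_boundD.
    exact: op_bound_le min1 (SS' t tM).
  by apply: op_bound_le (SB t tM) _; exact/psd_op_bound/psd_next_weight.
have h3 : mu * fnorm E <= fnorm G by apply: psd_fnorm; exact: cost_to_go_ge.
have h4 : - (fnorm G ^+ 2 / 2) <= mdot G ((S' - S) *m E).
  have := normr_mdot_le G ((S' - S) *m E).
  have : fnorm ((S' - S) *m E) <= mu / 2 * fnorm E.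
    rewrite (le_trans (op_bound_fnorm _ min0 (SS' t tM)))//.
    by rewrite ler_wpM2r ?fnorm_ge0.
  have G0 := fnorm_ge0 G; rewrite ler_norml => h /andP[h' _].
  apply: le_trans h'; rewrite lerN2 expr2 -mulrA ler_wpM2l//; lra.
rewrite -!scalemxAr -scalemxAl !mdotZl mdotZr.
have -> : mdot G (S' *m E) = mdot G G + mdot G ((S' - S) *m E).
  by rewrite -mdotDr mulmxBl addrC subrK.
rewrite sqr_fnorm in h4.
set x := mdot G G in h2 h4 *; set y := mdot G (_ *m E) in h4 *.
set z := mdot G (S' *m G) in h1 h2 *; set o := mdot G (S' *m G *m W) in h1 *.
have x0 : 0 <= x := mdotxx_ge0 _.
have h5 : 4 * eta * o <= x.
  apply: (@le_trans _ _ (eta * (4 * w * (2^-1 + B)) * x)); last first.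
    by rewrite -[leRHS]mul1r ler_wpM2r.
  have -> : eta * (4 * w * (2^-1 + B)) * x =
    4 * eta * (w * ((2^-1 + B) * x)) by ring.
  by rewrite ler_pM2l ?mulr_gt0// (le_trans h1)// ler_pM2l.
have -> : 2 * (- (2 * eta) * (x + y)) + - (2 * eta) * (- (2 * eta) * o) =
  eta * (- 4 * x - 4 * y + 4 * eta * o) by ring.
have -> : - (eta / 4 * (4 * x)) = eta * (- x) by field.
rewrite ler_pM2l//; lra.
Qed.

(** The geometric sum of s rho^(2 i) over i <= n, in the recursive form of [cost_to_go] when |Sg| <=
    s and each |F_t| <= rho. *)
Fixpoint geom_weight (s rho : R) n : R :=
  if n is n'.+1 then s + rho ^+ 2 * geom_weight s rho n' else s.

Lemma geom_weight_ge0 s rho n : 0 <= s -> 0 <= geom_weight s rho n.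
Proof.
move=> s0; elim: n => [//|n IH] /=.
by rewrite addr_ge0// mulr_ge0// sqr_ge0.
Qed.

(** With G = F' - F, the gap obeys F'^T (S' - S) F' + G^T S F' + F^T S G. A total perturbation of at
    most 1/6 keeps its growth linear in the sum of the [delta i], with constant 3, instead of
    exponential in the horizon. *)
Lemma cost_to_go_perturb k k' s rho (delta : nat -> R) n t :
  0 <= s -> op_bound Sg s -> 1 <= rho -> (forall i, 0 <= delta i) ->
  (forall i, (t <= i < t + n)%N -> op_bound (err_dyn (k i)) rho) ->
  (forall i, (t <= i < t + n)%N ->
     op_bound (err_dyn (k' i) - err_dyn (k i)) (delta i)) ->
  \sum_(i < n) delta (t + i)%N <= 6^-1 ->
  op_bound (cost_to_go k n t) (geom_weight s rho n) /\
  op_bound (cost_to_go k' n t - cost_to_go k n t)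
      (geom_weight s rho n * (3 * \sum_(i < n) delta (t + i)%N)).
Proof.
move=> s0 Sgs rho1 delta0; elim: n t => [|n IH] t Hk Hk' dn.
  split=> //= x; rewrite subrr mul0mx fnorm0 big_ord0.
  by rewrite !mulr0 mul0r.
have tt : (t <= t < t + n.+1)%N by rewrite leqnn addnS ltnS leq_addr.
have dE : \sum_(i < n.+1) delta (t + i)%N =
    delta t + \sum_(i < n) delta (t.+1 + i)%N.
  rewrite big_ord_recl addn0; congr (_ + _); apply: eq_bigr => i _.
  by rewrite lift0 addnS addSn.
rewrite dE in dn *.
have [|||] := IH t.+1.
- by move=> i /andP[ti it]; apply: Hk; rewrite ltnW//= -addSnnS.
- by move=> i /andP[ti it]; apply: Hk'; rewrite ltnW//= -addSnnS.
- by apply: le_trans dn; rewrite lerDr.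
set a := geom_weight s rho n; set sg := \sum_(i < n) _ in dn *.
have a0 : 0 <= a := geom_weight_ge0 _ _ s0.
have sg0 : 0 <= sg by apply: sumr_ge0.
have rho0 : 0 <= rho by exact: le_trans rho1.
move=> Ha Hd; have {}Hk := Hk t tt; have {}Hk' := Hk' t tt.
have d0 := delta0 t; split=> /=.
  apply: op_boundD => //; rewrite expr2 -mulrA [rho * a]mulrC mulrA.
  apply: (op_boundM _ _ Hk); first exact: mulr_ge0.
  by apply: op_boundM => //; apply: op_bound_tr.
rewrite opprD addrACA subrr add0r.
move: Ha Hd Hk Hk'.
set S := cost_to_go k n t.+1; set S' := cost_to_go k' n t.+1.
set F := err_dyn (k t); set F' := err_dyn (k' t) => Ha Hd Hk Hk'.
set G := F' - F.
have Fr : op_bound F' (rho + delta t).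
  by rewrite -(subrK F F') addrC; apply: op_boundD.
have -> : F'^T *m S' *m F' - F^T *m S *m F =
  F'^T *m (S' - S) *m F' + (G^T *m S *m F' + F^T *m S *m G).
  rewrite /G [(F' - F)^T]linearB/= !(mulmxBl, mulmxBr).
  apply/matrixP => u v; rewrite !mxE; ring.
apply: (@op_bound_le _ _ _ _
  ((rho + delta t) * (a * (3 * sg)) * (rho + delta t) +
  (delta t * a * (rho + delta t) + rho * a * delta t))); last first.
  have rd0 : 0 <= rho + delta t by exact: addr_ge0.
  have s3 : 0 <= 3 * sg by exact: mulr_ge0.
  have ra0 : 0 <= rho * a by exact: mulr_ge0.
  have da0 : 0 <= delta t * a by exact: mulr_ge0.
  have rs0 : 0 <= (rho + delta t) * (a * (3 * sg)) by rewrite !mulr_ge0.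
  apply: op_boundD (op_boundM rs0 (op_boundM rd0 (op_bound_tr rd0 Fr) Hd) Fr) _.
  apply: op_boundD (op_boundM da0 (op_boundM d0 (op_bound_tr d0 Hk') Ha) Fr) _.
  exact: op_boundM ra0 (op_boundM rho0 (op_bound_tr rho0 Hk) Ha) Hk'.
have -> : (rho + delta t) * (a * (3 * sg)) * (rho + delta t) +
    (delta t * a * (rho + delta t) + rho * a * delta t) =
    a * (3 * sg * (rho + delta t) ^+ 2 + delta t * (2 * rho + delta t)) by ring.
apply: (@le_trans _ _ (a * (3 * rho ^+ 2 * (delta t + sg)))); last first.
  have -> : a * (3 * rho ^+ 2 * (delta t + sg)) =
    rho ^+ 2 * a * (3 * (delta t + sg)) by ring.
  by rewrite ler_wpM2r ?lerDr// mulr_ge0// addr_ge0.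
rewrite ler_wpM2l// -subr_ge0; set e := delta t in d0 dn *.
(* This is the case rho = 1 of the required inequality. Multiplying by rho^2 suffices for rho >= 1,
   since each term absorbed carries at most that power; [p1] to [p4] record the surplus. *)
have h1 : e * (6 * sg + 2 + e + 3 * e * sg) <= 3 * e.
  have : 3 * e * sg <= e by nra.
  nra.
have : e * (6 * sg + 2 + e + 3 * e * sg) * rho ^+ 2 <= 3 * e * rho ^+ 2.
  by rewrite ler_wpM2r// sqr_ge0.
have h2 : 0 <= rho * (rho - 1) by rewrite mulr_ge0// subr_ge0.
have h3 : 0 <= (rho ^+ 2 - 1).
  by rewrite subr_ge0 -(expr1n _ 2) ler_sqr// nnegrE.
have p1 : 0 <= e * sg * (rho * (rho - 1)).
  by apply: mulr_ge0 => //; exact: mulr_ge0.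
have p2 : 0 <= e * (rho * (rho - 1)) by exact: mulr_ge0.
have p3 : 0 <= e ^+ 2 * (rho ^+ 2 - 1) by apply: mulr_ge0 => //; exact: sqr_ge0.
have p4 : 0 <= e ^+ 2 * sg * (rho ^+ 2 - 1).
  by apply: mulr_ge0 => //; apply: mulr_ge0 => //; exact: sqr_ge0.
lra.
Qed.

(** Solve the residual for the gain: W L^T = E^T + C A P A^T + C Q, and W >= lo. The three summands
    are those of [calC]. *)
Lemma gain_op_bound L t P e na np nca ncq lo :
  psd P -> 0 < lo -> psd (Rv t.+1 - lo%:M) ->
  0 <= e -> 0 <= na -> 0 <= np -> 0 <= nca -> 0 <= ncq ->
  op_bound (half_grad L t P) e -> op_bound A na -> op_bound P np ->
  op_bound (C *m A) nca ->
  op_bound (C *m Q t) ncq ->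
  op_bound L ((e + np * nca * na + ncq) / lo).
Proof.
move=> pP lo0 Rlo e0 na0 np0 nca0 ncq0 Ee Aa Pp CAc CQc.
have c0 : 0 <= (e + np * nca * na + ncq) / lo.
  by rewrite divr_ge0 ?(ltW lo0)// !addr_ge0// !mulr_ge0.
rewrite -(trmxK L); apply: op_bound_tr => // x.
rewrite mulrAC ler_pdivlMr//.
have Wlo : psd (innov t P - lo%:M).
  rewrite /innov -addrA; apply: psdD => //.
  exact/psd_conj/psd_predict.
rewrite mulrC (le_trans (psd_fnorm Wlo _))//.
have -> : innov t P *m (L^T *m x) =
    ((half_grad L t P)^T + C *m A *m P *m A^T + C *m Q t) *m x.
  rewrite mulmxA; congr (_ *m x).
  rewrite -{1}(psd_innov t pP).1 -trmx_mul.
  rewrite (_ : L *m innov t P = half_grad L t P + predict t P *m C^T).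
    rewrite linearD/= -addrA; congr (_ + _).
    by rewrite trmx_mul trmxK (psd_predict t pP).1 /predict mulmxDr !mulmxA.
  by rewrite /half_grad subrK.
have : op_bound ((half_grad L t P)^T + C *m A *m P *m A^T + C *m Q t)
  (e + np * nca * na + ncq).
  apply: op_boundD => //; apply: op_boundD; first by apply: op_bound_tr.
  apply: op_boundM; [exact: mulr_ge0| |by apply: op_bound_tr].
  by rewrite mulrC; apply: op_boundM.
by apply.
Qed.

End Gradient.

End ErrorCovariance.

(** * Second moments of the estimation error *)

Section Expectation.
Context {R : realType} {d : measure_display} {Omega : measurableType d}.
Variable P : probability Omega R.
Implicit Types (Y Z : Omega -> R) (a b c : R).
Local Open Scope classical_set_scope.

(** Integrability is kept together with the value so that linearity applies without side
    conditions. *)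
Definition has_expectation Z c : Prop :=
  P.-integrable setT (EFin \o Z) /\ (\int[P]_o (Z o)%:E = c%:E)%E.

Lemma has_expectationE Z c : has_expectation Z c -> ('E_P[Z] = c%:E)%E.
Proof. by move=> [_]; rewrite unlock. Qed.

Lemma has_expectationD Y Z a b : has_expectation Y a -> has_expectation Z b ->
  has_expectation (fun o => Y o + Z o) (a + b).
Proof.
move=> [iY eY] [iZ eZ]; split; first exact: (integrableD _ iY iZ).
by under eq_integral do rewrite EFinD; rewrite integralD// eY eZ.
Qed.

Lemma has_expectationZ a Z c : has_expectation Z c ->
  has_expectation (fun o => a * Z o) (a * c).
Proof.
move=> [iZ eZ]; split; first exact: (integrableZl _ a iZ).
by under eq_integral do rewrite EFinM; rewrite integralZl// eZ.
Qed.

Lemma has_expectation0 : has_expectation (cst 0) 0.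
Proof. by split; [exact: integrable0|rewrite integral0]. Qed.

Lemma has_expectation_sum (I : finType) (Z : I -> Omega -> R) (c : I -> R) :
  (forall i, has_expectation (Z i) (c i)) ->
  has_expectation (fun o => \sum_i Z i o) (\sum_i c i).
Proof.
move=> Zc; rewrite /index_enum; elim: (Finite.enum I) => [|i r IH].
  rewrite big_nil (_ : (fun _ => _) = cst 0); first exact: has_expectation0.
  by apply/funext => o; rewrite big_nil.
rewrite big_cons (_ : (fun _ => _) = fun o => Z i o + \sum_(j <- r) Z j o).
  exact: has_expectationD.
by apply/funext => o; rewrite big_cons.
Qed.

(** The integral is the difference of those of the positive and negative parts; in the extended
    reals it is finite only if both are. *)
Lemma finite_has_expectation Z c : measurable_fun setT Z ->
  ('E_P[Z] = c%:E)%E -> has_expectation Z c.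
Proof.
rewrite unlock => mZ eZ; split=> //.
have mZ' : measurable_fun setT (EFin \o Z) by exact/measurable_EFinP.
apply/integrableP; split=> //.
have : (\int[P]_o (Z o)%:E \is a fin_num)%E by rewrite eZ.
rewrite integralE fin_numB => /andP[p n].
rewrite (_ : (fun o => `|(EFin \o Z) o|%E) =
  ((EFin \o Z)^\+ \+ (EFin \o Z)^\-)%E); last by rewrite -fune_abse.
rewrite ge0_integralD//.
- by rewrite lte_add_pinfty// ltey_eq ?p ?n.
- exact: measurable_funepos.
- exact: measurable_funeneg.
Qed.

(** Agreement on rectangles identifies the joint law with the product of the two laws; Tonelli gives
    integrability of the product and Fubini its value. *)
Lemma independent_expectation Y Z a b :
  measurable_fun setT Y -> measurable_fun setT Z ->
  (forall A B : set R, measurable A -> measurable B ->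
     P ((Y @^-1` A) `&` (Z @^-1` B)) = (P (Y @^-1` A) * P (Z @^-1` B))%E) ->
  has_expectation Y a -> has_expectation Z b ->
  has_expectation (fun o => Y o * Z o) (a * b).
Proof.
move=> mY mZ indep [iY eY] [iZ eZ].
pose RY : {RV P >-> R} := HB.pack Y (isMeasurableFun.Build _ _ _ _ _ mY).
pose RZ : {RV P >-> R} := HB.pack Z (isMeasurableFun.Build _ _ _ _ _ mZ).
pose mu := distribution P RY; pose nu := distribution P RZ.
have mYZ : measurable_fun setT (fun o => (Y o, Z o)).
  exact: measurable_fun_pair.
pose RYZ : {RV P >-> (R * R)%type} :=
  HB.pack (fun o => (Y o, Z o)) (isMeasurableFun.Build _ _ _ _ _ mYZ).
pose mn := distribution P RYZ.
have mnE (E : set (R * R)) : measurable E -> (mu \x nu)%E E = mn E.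
  apply: product_measure_unique => A B mA mB.
  by rewrite -indep.
have mnI (f : R * R -> \bar R) :
    (\int[distribution P RYZ]_z f z = \int[mu \x nu]_z f z)%E.
  by apply: eq_measure_integral => E mE _; exact/esym/mnE.
pose g (z : R * R) : \bar R := (z.1 * z.2)%:E.
have mg : measurable_fun setT g.
  by apply/measurable_EFinP; apply: measurable_funM.
have iid (T : {RV P >-> R}) : P.-integrable setT (EFin \o T) ->
  (distribution P T).-integrable setT (EFin : R -> \bar R).
  move=> iT; apply: integrable_pushforward => //; exact/measurable_EFinP.
have nu_fin : (\int[nu]_y `|y%:E| < +oo)%E by have /integrableP[] := iid RZ iZ.
have mu_fin : (\int[mu]_y `|y%:E| < +oo)%E by have /integrableP[] := iid RY iY.
have ig : (mu \x nu)%E.-integrable setT g.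
  apply/integrable12ltyP => //.
  have -> : (\int[mu]_x \int[nu]_y `|g (x, y)|)%E =
      (\int[mu]_x (`|x%:E| * \int[nu]_y `|y%:E|))%E.
    apply: eq_integral => x _; rewrite -ge0_integralZl//.
    - by apply: eq_integral => y _; rewrite /g/= normrM EFinM.
    - by apply: measurableT_comp => //; exact/measurable_EFinP.
  rewrite ge0_integralZr//.
  - by rewrite lte_mul_pinfty// ?ge0_fin_numE// integral_ge0.
  - by apply: measurableT_comp => //; exact/measurable_EFinP.
  - exact: integral_ge0.
have iYZ : P.-integrable setT (g \o RYZ).
  apply/integrableP; split; first exact: measurableT_comp.
  have mag : measurable_fun setT (abse \o g) by exact: measurableT_comp.
  have ag0 z : (0 <= (abse \o g) z)%E by exact: abse_ge0.
  rewrite -[ltLHS](ge0_integral_distribution RYZ mag ag0).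
  rewrite mnI.
  by have /integrableP[] := ig.
split=> //.
rewrite -[LHS](integral_distribution mg iYZ)//.
rewrite mnI.
rewrite -integral12_prod_meas1//.
have mE : measurable_fun setT (EFin : R -> \bar R) by exact/measurable_EFinP.
have eZ' : (\int[nu]_y y%:E)%E = b%:E.
  by rewrite (integral_distribution (X := RZ) mE iZ) [LHS]eZ.
have -> : (\int[mu]_x fubini_F nu g x)%E = (\int[mu]_x (x%:E * b%:E))%E.
  apply: eq_integral => x _; rewrite /fubini_F/= -eZ' -integralZl//.
  exact: iid.
rewrite integralZr//; last exact: iid.
by rewrite (integral_distribution (X := RY) mE iY) [X in (X * _)%E]eY EFinM.
Qed.

Definition has_cross_moment p q (X : Omega -> 'cV[R]_p) (Y : Omega -> 'cV[R]_q)
    (S : 'M[R]_(p, q)) : Prop :=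
  forall i j, has_expectation (fun o => X o i 0 * Y o j 0) (S i j).

Lemma has_cross_momentC p q (X : Omega -> 'cV[R]_p) (Y : Omega -> 'cV[R]_q) S :
  has_cross_moment X Y S -> has_cross_moment Y X S^T.
Proof.
move=> XY i j; rewrite mxE (_ : (fun _ => _) = fun o => X o j 0 * Y o i 0)//.
by apply/funext => o; rewrite mulrC.
Qed.

Lemma has_cross_momentDl p q (X X' : Omega -> 'cV[R]_p)
    (Y : Omega -> 'cV[R]_q) S S' :
  has_cross_moment X Y S -> has_cross_moment X' Y S' ->
  has_cross_moment (fun o => X o + X' o) Y (S + S').
Proof.
move=> XY X'Y i j; rewrite mxE.
rewrite (_ : (fun _ => _) = fun o => X o i 0 * Y o j 0 + X' o i 0 * Y o j 0).
  exact: has_expectationD.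
by apply/funext => o; rewrite mxE mulrDl.
Qed.

Lemma has_cross_momentMl p q r (A : 'M[R]_(r, p)) (X : Omega -> 'cV[R]_p)
    (Y : Omega -> 'cV[R]_q) S :
  has_cross_moment X Y S -> has_cross_moment (fun o => A *m X o) Y (A *m S).
Proof.
move=> XY i j; rewrite mxE.
rewrite (_ : (fun _ => _) = fun o => \sum_k A i k * (X o k 0 * Y o j 0)).
  by apply: has_expectation_sum => k; exact: has_expectationZ.
by apply/funext => o; rewrite mxE mulr_suml; under eq_bigr do rewrite -mulrA.
Qed.

Lemma has_cross_momentDr p q (X : Omega -> 'cV[R]_p)
    (Y Y' : Omega -> 'cV[R]_q) S S' :
  has_cross_moment X Y S -> has_cross_moment X Y' S' ->
  has_cross_moment X (fun o => Y o + Y' o) (S + S').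
Proof.
move=> /has_cross_momentC XY /has_cross_momentC XY'.
rewrite -[S + S']trmxK linearD/=.
exact/has_cross_momentC/has_cross_momentDl.
Qed.

Lemma has_cross_momentMr p q r (A : 'M[R]_(r, q)) (X : Omega -> 'cV[R]_p)
    (Y : Omega -> 'cV[R]_q) S :
  has_cross_moment X Y S -> has_cross_moment X (fun o => A *m Y o) (S *m A^T).
Proof.
move=> /has_cross_momentC XY; rewrite -[S *m A^T]trmxK trmx_mul trmxK.
exact/has_cross_momentC/has_cross_momentMl.
Qed.

End Expectation.

Section EstimationError.
Context {R : realType} {d : measure_display} {Omega : measurableType d}.
Variable P : probability Omega R.
Context {M N m : nat}.
Variables (A : 'M[R]_N) (C : 'M[R]_(m, N)) (xbar0 : 'cV[R]_N).
Variables (x0 : Omega -> 'cV[R]_N) (w : nat -> Omega -> 'cV[R]_N).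
Variable v : nat -> Omega -> 'cV[R]_m.
Variables (Q : nat -> 'M[R]_N) (Rv : nat -> 'M[R]_m) (P0 : 'M[R]_N).

Hypothesis x0x0 :
  has_cross_moment P (fun o => x0 o - xbar0) (fun o => x0 o - xbar0) P0.
Hypothesis ww : forall s t,
  has_cross_moment P (w s) (w t) (if s == t then Q s else 0).
Hypothesis vv : forall s t,
  has_cross_moment P (v s) (v t) (if s == t then Rv s else 0).
Hypothesis x0w : forall t, has_cross_moment P (fun o => x0 o - xbar0) (w t) 0.
Hypothesis x0v : forall t, has_cross_moment P (fun o => x0 o - xbar0) (v t) 0.
Hypothesis wv : forall s t, has_cross_moment P (w s) (v t) 0.

Local Notation err K := (est_error A C xbar0 x0 w v (M := M) K).

(** The state cancels: the error alone follows a linear recursion driven by [w t] and [v t.+1]. *)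
Lemma est_errorS (K : gain R M N m) t o : err K t.+1 o =
  (1%:M - gain_at K t *m C) *m (A *m err K t o + w t o)
  + - gain_at K t *m v t.+1 o.
Proof.
rewrite /est_error /=; move: (state _ _ _ _ _) (estimate _ _ _ _ _ _ _ _ _).
move=> x y; move: (gain_at K t) => g.
rewrite mulmxBl mul1mx mulNmx (mulmxDr (g *m C)) mulmxA (mulmxBr A x y).
apply/matrixP => i j; rewrite !mxE; ring.
Qed.

(** The error at time [t] has used the [w s] with s < t and the [v s] with s <= t, hence the two
    different ranges of orthogonality. The covariance recursion needs both, so the three claims go
    through one induction. *)
Lemma est_error_moments (K : gain R M N m) t :
  [/\ has_cross_moment P (err K t) (err K t)
        (err_cov A C Q Rv P0 (gain_at K) t),
      forall s, (t <= s)%N -> has_cross_moment P (err K t) (w s) 0 &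
      forall s, (t < s)%N -> has_cross_moment P (err K t) (v s) 0].
Proof.
elim: t => [|t [ee ew ev]]; first by split=> [|s _|s _].
have -> : err K t.+1 = fun o =>
    (1%:M - gain_at K t *m C) *m (A *m err K t o + w t o)
    + - gain_at K t *m v t.+1 o by apply/funext => o; exact: est_errorS.
set g := gain_at K t.
pose y o := A *m err K t o + w t o.
have yw s : (t < s)%N -> has_cross_moment P y (w s) 0.
  move=> ts; have wts := ww t s; rewrite ltn_eqF// in wts.
  have := has_cross_momentDl (has_cross_momentMl A (ew s (ltnW ts))) wts.
  by rewrite mulmx0 addr0.
have yv s : (t < s)%N -> has_cross_moment P y (v s) 0.
  move=> ts.
  have := has_cross_momentDl (has_cross_momentMl A (ev s ts)) (wv t s).
  by rewrite mulmx0 addr0.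
have yy : has_cross_moment P y y
    (predict A Q t (err_cov A C Q Rv P0 (gain_at K) t)).
  have ewt := ew t (leqnn t).
  rewrite /predict -[X in has_cross_moment _ _ _ (X + _)]addr0.
  rewrite -[Q t]add0r; apply: has_cross_momentDr.
    rewrite -[X in _ *m _ *m _ + X](mul0mx _ A^T) -mulmxDl.
    apply: has_cross_momentMr; apply: has_cross_momentDl.
      exact: has_cross_momentMl.
    by rewrite -[0]trmx0; exact: has_cross_momentC.
  apply: has_cross_momentDl; last by have := ww t t; rewrite eqxx.
  by rewrite -(mulmx0 _ A); exact: has_cross_momentMl.
have vt s : (t.+1 < s)%N -> has_cross_moment P (v t.+1) (v s) 0.
  by move=> ts; have := vv t.+1 s; rewrite ltn_eqF.
have vtw s : has_cross_moment P (v t.+1) (w s) 0.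
  by rewrite -[0]trmx0; exact: has_cross_momentC.
split=> [|s ts|s ts].
- have vtt : has_cross_moment P (v t.+1) (v t.+1) (Rv t.+1).
    by have := vv t.+1 t.+1; rewrite eqxx.
  have yvt := yv t.+1 (ltnSn t).
  have vty : has_cross_moment P (v t.+1) y 0.
    by rewrite -[0]trmx0; exact: has_cross_momentC.
  rewrite [err_cov _ _ _ _ _ _ t.+1]/= /cov_step -/g.
  set Y := predict _ _ _ _ in yy *.
  (* The vanishing cross moments are inserted as explicit zeros, to give the shape that the bilinear
     rules produce. *)
  have -> : (1%:M - g *m C) *m Y *m (1%:M - g *m C)^T + g *m Rv t.+1 *m g^T =
     ((1%:M - g *m C) *m Y + - g *m 0) *m (1%:M - g *m C)^T
     + ((1%:M - g *m C) *m 0 + - g *m Rv t.+1) *m (- g)^T.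
    rewrite !mulmx0 addr0 add0r [(- g)^T]linearN/=.
    by rewrite mulNmx mulmxN mulNmx opprK.
  apply: has_cross_momentDr.
    apply: (@has_cross_momentMr _ _ _ _ _ _ _ _ _ y).
    by apply: has_cross_momentDl; exact: has_cross_momentMl.
  apply: has_cross_momentMr.
  by apply: has_cross_momentDl; exact: has_cross_momentMl.
- have := has_cross_momentDl (has_cross_momentMl (1%:M - g *m C) (yw s ts))
    (has_cross_momentMl (- g) (vtw s)).
  by rewrite !mulmx0 addr0.
- have := has_cross_momentDl
    (has_cross_momentMl (1%:M - g *m C) (yv s (ltnW ts)))
    (has_cross_momentMl (- g) (vt s ts)).
  by rewrite !mulmx0 addr0.
Qed.

Lemma costE (K : gain R M N m) : cost P A C xbar0 x0 w v K =
  total_cost A C Q Rv P0 (gramian A C) (gain_at K) M.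
Proof.
rewrite /cost /total_cost; set G := gramian A C.
suff h : has_expectation P (fun o => \tr (\sum_(t < M)
    err K t.+1 o *m (err K t.+1 o)^T *m G))
    (\sum_(t < M) \tr (err_cov A C Q Rv P0 (gain_at K) t.+1 *m G)).
  by rewrite (has_expectationE h).
rewrite (_ : (fun _ => _) = fun o => \sum_(t < M) \sum_i \sum_j
    G j i * (err K t.+1 o i 0 * err K t.+1 o j 0)); last first.
  apply/funext => o; rewrite raddf_sum; apply: eq_bigr => t _.
  move: (err K t.+1 o) => e.
  apply: eq_bigr => i _; rewrite mxE; apply: eq_bigr => j _.
  by rewrite mxE big_ord1 mxE mulrC.
apply: has_expectation_sum => t.
have [ee _ _] := est_error_moments K t.+1.
move: (err_cov _ _ _ _ _ _ _) ee => S ee.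
apply: has_expectation_sum => i; rewrite mxE.
apply: has_expectation_sum => j; rewrite mulrC.
exact: has_expectationZ.
Qed.

End EstimationError.

(** * Convergence of gradient descent *)

Section GainGradient.
Context {R : realType} {M N m : nat}.
Variables (A : 'M[R]_N) (C : 'M[R]_(m, N)).
Variables (Q : nat -> 'M[R]_N) (Rv : nat -> 'M[R]_m).
Variables (P0 Sg : 'M[R]_N).
Hypotheses (pP0 : psd P0) (pSg : psd Sg).
Hypotheses (pQ : forall t, psd (Q t)) (pRv : forall t, psd (Rv t)).

Local Notation total k := (total_cost A C Q Rv P0 Sg k M).
Local Notation weight := (next_weight A C Sg M).
Local Notation resid := (residual A C Q Rv P0).

Lemma derive1_quadratic (f : R -> R) a b :
  (forall h, f h = f 0 + a * h + b * h ^+ 2) -> derive1 f 0 = a.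
Proof.
move=> fE; have -> : f = (fun h => f 0 + a * h + b * h ^+ 2) by apply/funext.
rewrite derive1E; apply: (@derive_val _ _ _ _ _ _ _ _).
apply: is_derive_eq.
rewrite /GRing.scale/=; ring.
Qed.

Lemma gain_at_ord (K : gain R M N m) (t : 'I_M) : gain_at K t = K t.
Proof. by rewrite /gain_at valK. Qed.

Lemma gain_atD (K D : gain R M N m) t :
  gain_at (K + D) t = gain_at K t + gain_at D t.
Proof. by rewrite /gain_at; case: insub => [i|]; rewrite ?ffunE ?addr0. Qed.

Lemma gain_at_fun (k : nat -> 'M[R]_(N, m)) t : (t < M)%N ->
  gain_at [ffun i : 'I_M => k i] t = k t.
Proof.
by move=> tM; rewrite -[t]/(nat_of_ord (Ordinal tM)) gain_at_ord ffunE.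
Qed.

(** In [total_cost_diff] only the term at [t] survives, and its weight involves later gains only;
    the cost is thus exactly quadratic in one gain entry. *)
Lemma total_cost_perturb (K : gain R M N m) (t : 'I_M) i j h :
  total (gain_at (K + h *: gain_dir t i j)) = total (gain_at K)
  + 2 * (weight (gain_at K) t *m resid (gain_at K) t) i j * h
  + mdot (delta_mx i j) (weight (gain_at K) t *m delta_mx i j
      *m innov A C Q Rv t (err_cov A C Q Rv P0 (gain_at K) t)) * h ^+ 2.
Proof.
set k := gain_at K; set k' := gain_at (K + _).
have kk' s : k' s - k s = if s == t :> nat then h *: delta_mx i j else 0.
  rewrite /k' gain_atD addrAC subrr add0r.
  have [sM|Ms] := ltnP s M.
    rewrite -[s]/(nat_of_ord (Ordinal sM)) gain_at_ord !ffunE val_eqE.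
    by case: eqP => _; rewrite ?scaler0.
  rewrite /gain_at insubF; last by rewrite ltnNge Ms.
  by case: eqP => // st; move: (ltn_ord t); rewrite -st ltnNge Ms.
rewrite -[total k'](subrK (total k)) total_cost_diff//.
rewrite (bigD1 t)//= big1 ?addr0 => [|s st].
  rewrite kk' eqxx; have -> : cost_to_go A C Sg k' (M - t.+1) t.+1 = weight k t.
    apply: eq_cost_to_go => s ts; apply/eqP; rewrite -subr_eq0 kk'.
    by rewrite gtn_eqF.
  rewrite -/(resid k t) -!scalemxAr -scalemxAl !mdotZl !mdotZr mdot_delta; ring.
by rewrite kk' val_eqE (negPf st) !mdot0l mulr0 addr0.
Qed.

Lemma grad_total_cost (K : gain R M N m) t :
  grad (fun K => total (gain_at K)) K t =
  2 *: (weight (gain_at K) t *m resid (gain_at K) t).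
Proof.
rewrite ffunE; apply/matrixP => i j; rewrite !mxE -[RHS]/(2 * _).
apply: derive1_quadratic => h; rewrite total_cost_perturb scale0r addr0.
by rewrite !mxE.
Qed.

Lemma gradient_step (K : gain R M N m) eta t : (t < M)%N ->
  gain_at (K - eta *: grad (fun K => total (gain_at K)) K) t =
  gain_at K t - (2 * eta) *: (weight (gain_at K) t *m resid (gain_at K) t).
Proof.
move=> tM; rewrite gain_atD; congr (_ + _).
rewrite -[t]/(nat_of_ord (Ordinal tM)) gain_at_ord.
by rewrite 2!ffunE grad_total_cost scalerA mulrC.
Qed.

End GainGradient.

(** * Scalar estimates behind the step size *)

Section Bounds.
Context {R : realType}.

Lemma psd_shift_le n (S : 'M[R]_n) c c' : c' <= c -> psd (S - c%:M) ->
  psd (S - c'%:M).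
Proof.
move=> cc' pS; rewrite -[S](subrK c%:M) -addrA -raddfB/=; apply: psdD => //.
by apply: psd_scalar; rewrite subr_ge0.
Qed.

Lemma op_bound_psd n (S : 'M[R]_n) c :
  0 <= c -> S^T = S -> op_bound S c -> psd (c%:M - S).
Proof.
move=> c0 sS Sc; split=> [|x]; first by rewrite linearB/= tr_scalar_mx sS.
rewrite mulmxBl mul_scalar_mx mdotBr mdotZr subr_ge0.
exact: op_bound_quadratic.
Qed.

Lemma trace_op_bound n (S : 'M[R]_n) c : 0 <= c -> psd S -> op_bound S c ->
  \tr S <= n%:R * c.
Proof.
move=> c0 pS Sc; have := psd_trace (op_bound_psd c0 pS.1 Sc).
by rewrite linearB/= mxtrace_scalar subr_ge0 mulr_natl.
Qed.

Lemma psd_op_bound_le n (S : 'M[R]_n) c d : (0 < n)%N -> 0 <= d ->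
  psd (S - c%:M) -> op_bound S d -> c <= d.
Proof.
move=> n0 d0 pS Sd.
have := psd_quadratic pS (delta_mx (Ordinal n0) 0 : 'cV[R]_n).
move=> /le_trans/(_ (op_bound_quadratic _ d0 Sd)).
by rewrite mdot_delta mxE !eqxx !mulr1.
Qed.

(** Cauchy-Schwarz against the all-ones vector; the source of the factor [M] in [gap_root]. *)
Lemma sqr_sum_le n (x : 'I_n -> R) :
  (\sum_i x i) ^+ 2 <= n%:R * \sum_i x i ^+ 2.
Proof.
have := mdot_CS (const_mx 1 : 'cV[R]_n) (\col_i x i).
rewrite !mdotE !big_ord1.
under eq_bigr do rewrite !mxE mul1r.
under [X in _ <= X * _ -> _]eq_bigr do rewrite !mxE mul1r.
under [X in _ <= _ * X -> _]eq_bigr do rewrite !mxE -expr2.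
by rewrite sumr_const card_ord.
Qed.

Lemma min_time_le M (F : nat -> R) t : (t < M)%N -> min_time (M := M) F <= F t.
Proof.
by move=> tM; exact: (bigmin_le _ (Ordinal tM) (fun i : 'I_M => F i)).
Qed.

Lemma le_max_time M (F : nat -> R) t : (t < M)%N -> F t <= max_time (M := M) F.
Proof.
by move=> tM; exact: (le_bigmax _ (fun i : 'I_M => F i) (Ordinal tM)).
Qed.

Lemma min_time_gt0 M (F : nat -> R) :
  (forall t, 0 < F t) -> 0 < min_time (M := M) F.
Proof. by move=> F0; apply: lt_bigmin. Qed.

Lemma sum_tail_le (F : nat -> R) t n : (forall i, 0 <= F i) ->
  \sum_(i < n) F (t + i)%N <= \sum_(i < t + n) F i.
Proof. by move=> F0; rewrite big_split_ord/= lerDr sumr_ge0. Qed.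

(** The arithmetic of [c3]: [T] bounds the total perturbation, [G] is the geometric quotient, s =
    |Sigma| and c = min(1, mu). Since 2 r + 1 >= 3, the hypothesis gives 6 T G s <= c; then c <= s
    and G >= 1 give T <= 1/6. *)
Lemma step_size_small (T G r s c : R) : 0 <= T -> 1 <= G -> 1 < r -> 0 < s ->
  c <= s -> T * (2 * G * (2 * r + 1) * s) <= c ->
  T <= 6^-1 /\ s * G * (3 * T) <= c / 2.
Proof.
move=> T0 G1 r1 s0 cs Tc.
have TGs : 0 <= T * G * s.
  by apply: mulr_ge0 (ltW s0); apply: mulr_ge0 => //; exact: le_trans G1.
have TGs6 : 6 * (T * G * s) <= c.
  apply: le_trans Tc.
  have : 0 <= (r - 1) * (T * G * s) by rewrite mulr_ge0// subr_ge0 ltW.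
  lra.
split; last lra.
have TG : 6 * (T * G) <= 1.
  by rewrite -(ler_pM2r s0) mul1r -mulrA (le_trans TGs6).
have : T <= T * G by rewrite ler_peMr.
lra.
Qed.

Lemma geom_weightE (s rho : R) n : 1 < rho ->
  geom_weight s rho n = s * ((rho ^+ (2 * n.+1) - 1) / (rho ^+ 2 - 1)).
Proof.
move=> rho1; have r0 : rho ^+ 2 - 1 != 0.
  by rewrite gt_eqF// subr_gt0 exprn_egt1.
elim: n => [|n IH] /=; first by rewrite muln1 divff// mulr1.
by rewrite IH [(2 * n.+2)%N]mulnS exprD; field.
Qed.

Lemma geom_weight_mono (s rho : R) n n' : 0 <= s -> 1 <= rho -> (n <= n')%N ->
  geom_weight s rho n <= geom_weight s rho n'.
Proof.
move=> s0 rho1 /subnK <-; elim: (n' - n)%N => [//|i IH].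
rewrite addSn (le_trans IH)//=; set x := geom_weight _ _ _.
have x0 : 0 <= x by exact: geom_weight_ge0.
have : x <= rho ^+ 2 * x by rewrite ler_peMl// exprn_ege1.
lra.
Qed.

End Bounds.

(** * Uniform estimates on the sublevel set of [K0] *)

Section Convergence.
Context {R : realType} {M N m : nat}.
Variables (A : 'M[R]_N) (C : 'M[R]_(m, N)).
Variables (Q : nat -> 'M[R]_N) (Rv : nat -> 'M[R]_m) (P0 : 'M[R]_N).
Hypotheses (M_gt0 : (0 < M)%N) (N_gt0 : (0 < N)%N) (m_gt0 : (0 < m)%N).
Hypotheses (pP0 : psd P0) (A_unit : A \in unitmx).
Hypotheses (Sg_posdef : posdef (gramian A C)).
Hypotheses (Q_posdef : forall t, posdef (Q t)).
Hypotheses (Rv_posdef : forall t, posdef (Rv t)).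

Local Notation Sg := (gramian A C).
Local Notation CA := (C *m A).
Local Notation total k := (total_cost A C Q Rv P0 Sg k M).
Local Notation weight := (next_weight A C Sg M).
Local Notation resid := (residual A C Q Rv P0).
Local Notation cov := (err_cov A C Q Rv P0).
Local Notation gsqr := (grad_sqr A C Q Rv P0 Sg M).

Let f (K : gain R M N m) : R := total (gain_at K).

Variables (Ks K0 : gain R M N m) (b : R).
Hypothesis Ks_min : forall K, f Ks <= f K.
Hypothesis b_gt0 : 0 < b.

Local Notation mu := (sigma_min Sg).
Local Notation lo := (sigma_low (M := M) Rv).
Local Notation q := (q_low (M := M) A Q).
Local Notation sbar := (sigma_bar (M := M) C Q Rv).
Local Notation nCA := (spectral_norm CA).
Local Notation nA := (spectral_norm A).
Local Notation nSg := (spectral_norm Sg).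
Local Notation cA := (calA A C P0 f K0).
Local Notation cB := (calB A C Q f).
Local Notation groot := (gap_root A C Q Rv P0 f Ks K0).
Local Notation cC := (calC A C Q Rv P0 f Ks K0).
Local Notation rho := (rho_max A C Q Rv P0 f Ks b K0).

Let pQ t : psd (Q t) := posdef_psd (Q_posdef t).
Let pRv t : psd (Rv t) := posdef_psd (Rv_posdef t).
Let pSg : psd Sg := posdef_psd Sg_posdef.
Let pcov k t : psd (cov k t) := psd_err_cov A C pP0 pQ pRv k t.

Let mu_gt0 : 0 < mu := sigma_min_gt0 N_gt0 Sg_posdef.
Let Sg_mu : psd (Sg - mu%:M) := psd_sigma_min N_gt0 pSg.
Let nCA_ge0 : 0 <= nCA := sigma_max_ge0 CA N_gt0.
Let nA_ge0 : 0 <= nA := sigma_max_ge0 A N_gt0.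
Let nSg_ge0 : 0 <= nSg := sigma_max_ge0 Sg N_gt0.

Let lo_gt0 : 0 < lo.
Proof. by apply: min_time_gt0 => t; exact: sigma_min_gt0. Qed.

Let Rv_lo t : (t < M)%N -> psd (Rv t.+1 - lo%:M).
Proof.
move=> tM; apply: psd_shift_le (psd_sigma_min m_gt0 (pRv t.+1)).
exact: (min_time_le (fun t => sigma_min (Rv t.+1)) tM).
Qed.

Let invQ_posdef t : posdef (invmx A *m Q t *m (invmx A)^T).
Proof.
apply/posdefE; split; first by case: (psd_conj (invmx A) (pQ t)).
move=> x x0; rewrite mdotC -!mulmxA mdot_mull mdotC.
have /posdefE[_] := Q_posdef t; apply; apply: contra_neq x0 => Ax0.
rewrite -[x]mul1mx -[1%:M]trmx1 -(mulVmx A_unit) trmx_mul -mulmxA Ax0.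
by rewrite mulmx0.
Qed.

Let q_gt0 : 0 < q.
Proof. by apply: min_time_gt0 => t; exact: sigma_min_gt0. Qed.

Let invQ_q t : (t < M)%N -> psd (invmx A *m Q t *m (invmx A)^T - q%:M).
Proof.
move=> tM; have := psd_sigma_min N_gt0 (posdef_psd (invQ_posdef t)).
apply: psd_shift_le.
exact: (min_time_le (fun t => sigma_min (invmx A *m Q t *m (invmx A)^T)) tM).
Qed.

Let mu_le_nSg : mu <= nSg.
Proof.
exact: psd_op_bound_le N_gt0 nSg_ge0 Sg_mu (sigma_max_op_bound Sg N_gt0).
Qed.

Let f_ge0 K : 0 <= f K.
Proof. exact: total_cost_ge0. Qed.

Let cA_ge0 : 0 <= cA.
Proof. by rewrite addr_ge0 ?divr_ge0 ?sigma_max_ge0 ?(ltW mu_gt0). Qed.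

Let cB_ge0 K : 0 <= cB K.
Proof. by rewrite addr_ge0 ?divr_ge0 ?mulr_ge0 ?sigma_max_ge0 ?(ltW q_gt0). Qed.

Let cB_gt0 K : 0 < cB K.
Proof.
apply: (@lt_le_trans _ _ (N%:R * nSg)).
  by apply: mulr_gt0; [rewrite ltr0n|exact: lt_le_trans mu_gt0 mu_le_nSg].
by rewrite lerDr divr_ge0// ltW.
Qed.

Let weight_trace K t : (t < M)%N -> \tr (weight (gain_at K) t) <= cB K.
Proof.
move=> tM.
have := trace_cost_to_go_bound C pP0 pSg pQ pRv (gain_at K) A_unit q_gt0
  invQ_q tM.
move=> /le_trans; apply.
rewrite lerD2l; apply: trace_op_bound => //; exact: sigma_max_op_bound.
Qed.

Let sbar_ge0 : 0 <= sbar.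
Proof.
apply: le_trans
  (le_max_time (fun t => sigma_max (C *m Q t *m C^T + Rv t.+1)) M_gt0).
exact: sigma_max_ge0.
Qed.

Local Notation w := (sbar + nCA ^+ 2 * cA).

Let w_gt0 : 0 < w.
Proof.
apply: (@lt_le_trans _ _ lo); first exact: lo_gt0.
apply: (@le_trans _ _ sbar); last first.
  by rewrite lerDl mulr_ge0 ?sqr_ge0.
apply: (psd_op_bound_le m_gt0 sbar_ge0).
  apply: (_ : psd (C *m Q 0%N *m C^T + Rv 1%N - lo%:M)).
  by rewrite -addrA; apply: psdD; [exact: psd_conj|exact: Rv_lo].
apply: op_bound_le (sigma_max_op_bound _ m_gt0).
exact: (le_max_time (fun t => sigma_max (C *m Q t *m C^T + Rv t.+1)) M_gt0).
Qed.

(** Origin of [calA]: the norm of [P0] serves time 0, while at later times mu tr P_t <= tr(P_t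
    Sigma) <= f(K). *)
Let cov_op_bound K t : f K <= f K0 -> (t < M)%N ->
  op_bound (cov (gain_at K) t) cA.
Proof.
move=> KK0; case: t => [|t] tM.
  apply: op_bound_le (sigma_max_op_bound P0 N_gt0).
  by rewrite lerDr divr_ge0//; exact: ltW.
apply: op_bound_le (psd_op_bound (pcov _ _)).
apply: (@le_trans _ _ (f K / mu)); last first.
  rewrite (le_trans (ler_wpM2r _ KK0)) ?invr_ge0 ?(ltW mu_gt0)//.
  by rewrite lerDl sigma_max_ge0.
rewrite ler_pdivlMr//.
apply: le_trans (trace_cov_le_total A C pP0 pSg pQ pRv (gain_at K) (ltnW tM)).
have := psd_trace_mul (pcov (gain_at K) t.+1) Sg_mu.
by rewrite mulmxBr mul_mx_scalar linearB/= linearZ/= subr_ge0 mulrC.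
Qed.

Let innov_w K t : f K <= f K0 -> (t < M)%N ->
  psd (w%:M - innov A C Q Rv t (cov (gain_at K) t)).
Proof.
move=> KK0 tM; have pI := psd_innov A C pQ pRv t (pcov (gain_at K) t).
apply: op_bound_psd pI.1 _; first exact: ltW.
rewrite (_ : innov _ _ _ _ _ _ =
    (C *m Q t *m C^T + Rv t.+1) + CA *m cov (gain_at K) t *m CA^T).
  apply: op_boundD.
    apply: op_bound_le (sigma_max_op_bound _ m_gt0).
    exact: (le_max_time (fun t => sigma_max (C *m Q t *m C^T + Rv t.+1)) tM).
  apply: op_bound_conj => //; first exact: sigma_max_op_bound.
  exact: cov_op_bound.
rewrite /innov /predict mulmxDr mulmxDl trmx_mul !mulmxA.
by rewrite -addrA addrC.
Qed.

Let c2_inv : (c2 A C Q Rv P0 f K0)^-1 = 4 * w / mu.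
Proof. by rewrite /c2 invf_div. Qed.

Let resid_sum K : f K <= f K0 ->
  \sum_(t < M) mdot (resid (gain_at K) t) (resid (gain_at K) t) <=
  w / mu * (f K0 - f Ks).
Proof.
move=> KK0.
apply: le_trans (residual_le_gap (k' := gain_at Ks) pP0 pSg pQ pRv _ w_gt0 _
  mu_gt0 Sg_mu) _.
- move=> k; have := Ks_min [ffun i : 'I_M => k i]; rewrite /f.
  by rewrite [leRHS](eq_total_cost A C Q Rv P0 Sg (gain_at_fun k)).
- by move=> t tM; exact: innov_w.
- by rewrite ler_wpM2l ?divr_ge0 ?(ltW w_gt0) ?(ltW mu_gt0)// lerD2r.
Qed.

(** By Cauchy-Schwarz the squared sum is at most M (w / mu) times the gap; as 1 / c2 = 4 w / mu,
    this is a quarter of [groot] squared. *)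
Let resid_norm_sum K : f K <= f K0 ->
  \sum_(t < M) fnorm (resid (gain_at K) t) <= groot / 2.
Proof.
move=> KK0.
have s0 : 0 <= \sum_(t < M) fnorm (resid (gain_at K) t).
  by apply: sumr_ge0 => t _; exact: fnorm_ge0.
rewrite -ler_sqr ?nnegrE ?divr_ge0 ?sqrtr_ge0//.
rewrite (le_trans (sqr_sum_le _))// expr_div_n sqr_sqrtr; last first.
  rewrite c2_inv !mulr_ge0 ?invr_ge0 ?subr_ge0 ?Ks_min//; exact: ltW.
rewrite c2_inv; under eq_bigr do rewrite sqr_fnorm.
have -> : M%:R * (4 * w / mu) * (f K0 - f Ks) / 2 ^+ 2 =
    M%:R * (w / mu * (f K0 - f Ks)) :> R.
  by move: (w) mu_gt0 => x mu0; field; rewrite gt_eqF.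
exact: ler_wpM2l (resid_sum KK0).
Qed.

Let groot_ge0 : 0 <= groot := sqrtr_ge0 _.

Let resid_norm K t : f K <= f K0 -> (t < M)%N ->
  fnorm (resid (gain_at K) t) <= groot.
Proof.
move=> KK0 tM; have := resid_norm_sum KK0.
rewrite (bigD1 (Ordinal tM))//=.
have : 0 <= \sum_(i < M | i != Ordinal tM) fnorm (resid (gain_at K) i).
  by apply: sumr_ge0 => i _; exact: fnorm_ge0.
have := groot_ge0; move: (fnorm _) (\sum_(_ | _) _) => x y; lra.
Qed.

Let gain_cC K t : f K <= f K0 -> (t < M)%N -> op_bound (gain_at K t) cC.
Proof.
move=> KK0 tM.
have nCQ_ge0 i : 0 <= spectral_norm (C *m Q i) by exact: sigma_max_ge0.
have := gain_op_bound (L := gain_at K t) pQ pRv (pcov (gain_at K) t) lo_gt0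
  (Rv_lo tM) groot_ge0 nA_ge0 cA_ge0 nCA_ge0 (nCQ_ge0 t)
  (op_bound_le (resid_norm KK0 tM) (op_bound_fnormE _))
  (sigma_max_op_bound A N_gt0) (cov_op_bound KK0 tM)
  (sigma_max_op_bound CA N_gt0) (sigma_max_op_bound (C *m Q t) N_gt0).
apply: op_bound_le; rewrite mulrDl lerD2l.
rewrite (bigD1 (Ordinal tM))//= lerDl; apply: sumr_ge0 => i _.
exact: divr_ge0 (nCQ_ge0 i) (ltW lo_gt0).
Qed.

Let rho_gt1 : 1 < rho.
Proof. by rewrite lt_max ltrDl b_gt0 orbT. Qed.

Let dyn_rho K t : f K <= f K0 -> (t < M)%N ->
  op_bound (err_dyn A C (gain_at K t)) rho.
Proof.
move=> KK0 tM; have kC := gain_cC KK0 tM.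
have cC_ge0 : 0 <= cC.
  have cAn : 0 <= cA * nCA * nA := mulr_ge0 (mulr_ge0 cA_ge0 nCA_ge0) nA_ge0.
  apply: addr_ge0.
    exact: divr_ge0 (addr_ge0 groot_ge0 cAn) (ltW lo_gt0).
  apply: sumr_ge0 => i _; apply: divr_ge0 (ltW lo_gt0).
  exact: sigma_max_ge0.
apply: (@op_bound_le _ _ _ _ (nA + nCA * cC)); first by rewrite le_max lexx.
rewrite /err_dyn mulmxBl mul1mx -mulmxA mulrC; apply: op_boundD.
  exact: sigma_max_op_bound.
by apply: op_boundN; apply: op_boundM => //; exact: sigma_max_op_bound.
Qed.

Variable eta : R.
Hypothesis eta_gt0 : 0 < eta.
Hypothesis eta_c3 :
  eta * (2 * cB K0 * groot * ((rho ^+ (2 * M) - 1) / (rho ^+ 2 - 1))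
    * (2 * rho + 1) * nSg * Num.max nCA 1) <= Num.min 1 mu.
Hypothesis eta_c4 : eta * (4 * w * (2^-1 + cB K0)) <= 1.

Let cB_le K : f K <= f K0 -> cB K <= cB K0.
Proof. by move=> KK0; rewrite lerD2r ler_wpM2r ?invr_ge0 ?(ltW q_gt0). Qed.

(** Bound for the change 2 eta S E C A of the closed loop matrix at time [t], with |S| <= tr S <=
    [cB K0]. In the sum over [t], its factor 2 cancels the half in [resid_norm_sum]. *)
Let delta (K : gain R M N m) t : R :=
  2 * eta * cB K0 * nCA * fnorm (resid (gain_at K) t).

Let stepped (K : gain R M N m) t := gain_at K t
  - (2 * eta) *: (weight (gain_at K) t *m resid (gain_at K) t).

Let dyn_delta K t : f K <= f K0 -> (t < M)%N ->
  op_bound (err_dyn A C (stepped K t) - err_dyn A C (gain_at K t)) (delta K t).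
Proof.
move=> KK0 tM.
set D := (2 * eta) *: (weight (gain_at K) t *m resid (gain_at K) t).
rewrite err_dyn_diff -/D.
have B0 := cB_ge0 K0.
apply: (@op_bound_le _ _ _ _ (fnorm D * nCA)); last first.
  apply: op_boundM; [exact: fnorm_ge0|exact: op_bound_fnormE|].
  exact: sigma_max_op_bound.
have -> : delta K t =
    2 * eta * (cB K0 * fnorm (resid (gain_at K) t)) * nCA.
  by rewrite /delta; move: (cB K0) nCA (fnorm _) => *; ring.
have eta2 : 0 < 2 * eta by exact: mulr_gt0.
apply: (ler_wpM2r nCA_ge0); rewrite fnormZ (gtr0_norm eta2).
apply: ler_wpM2l; first exact: ltW.
apply: op_bound_fnorm => //.
apply: op_bound_le (psd_op_bound (psd_next_weight A C pSg M _ _)).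
exact: le_trans (weight_trace K tM) (cB_le KK0).
Qed.

Let delta_sum K : f K <= f K0 ->
  \sum_(t < M) delta K t <= eta * cB K0 * groot * Num.max nCA 1.
Proof.
move=> KK0; rewrite -mulr_sumr.
apply: (@le_trans _ _ (2 * eta * cB K0 * nCA * (groot / 2))).
  apply: ler_wpM2l (resid_norm_sum KK0); apply: mulr_ge0 nCA_ge0.
  by apply: mulr_ge0 (cB_ge0 K0); exact/ltW/mulr_gt0.
have -> : 2 * eta * cB K0 * nCA * (groot / 2) = eta * cB K0 * groot * nCA.
  by move: (cB K0) groot nCA => x y z; field.
apply: ler_wpM2l; last by rewrite le_max lexx.
exact: mulr_ge0 (mulr_ge0 (ltW eta_gt0) (cB_ge0 K0)) groot_ge0.
Qed.

Let weight_perturb K t : f K <= f K0 -> (t < M)%N ->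
  op_bound (weight (stepped K) t - weight (gain_at K) t) (Num.min 1 mu / 2).
Proof.
move=> KK0 tM.
set T := eta * cB K0 * groot * Num.max nCA 1.
have T0 : 0 <= T.
  apply: mulr_ge0; last by rewrite le_max ler01 orbT.
  exact: mulr_ge0 (mulr_ge0 (ltW eta_gt0) (cB_ge0 K0)) groot_ge0.
pose G := (rho ^+ (2 * M) - 1) / (rho ^+ 2 - 1).
(* The longest weight, used for the gain at time 0, makes M - 1 backward steps and sums M powers,
   which yields the exponent 2 M. *)
have G_geom s : geom_weight s rho M.-1 = s * G.
  by rewrite geom_weightE// prednK.
have G1 : 1 <= G.
  rewrite -[G]mul1r -G_geom; apply: (@geom_weight_mono _ 1 rho 0) => //.
  exact: ltW.
have rho1 := rho_gt1.
have min_mu : Num.min 1 mu <= nSg by rewrite ge_min mu_le_nSg orbT.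
have nSg0 : 0 < nSg := lt_le_trans mu_gt0 mu_le_nSg.
have [T6 TG] : T <= 6^-1 /\ nSg * G * (3 * T) <= Num.min 1 mu / 2.
  apply: (step_size_small T0 G1 rho1 nSg0 min_mu).
  apply: le_trans eta_c3.
  rewrite /T -/G le_eqVlt; apply/orP; left; apply/eqP.
  move: (cB K0) groot nCA (Num.max _ _) => *; ring.
have delta0 i : 0 <= delta K i.
  apply: mulr_ge0 (fnorm_ge0 _); apply: mulr_ge0 nCA_ge0.
  by apply: mulr_ge0 (cB_ge0 K0); exact/ltW/mulr_gt0.
have tail : \sum_(i < M - t.+1) delta K (t.+1 + i)%N <= T.
  apply: le_trans (delta_sum KK0).
  by have := sum_tail_le t.+1 (M - t.+1) delta0; rewrite subnKC.
have [] := @cost_to_go_perturb _ _ _ A C Sg (gain_at K) (stepped K) nSg rho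
  (delta K) (M - t.+1) t.+1 nSg_ge0 (sigma_max_op_bound Sg N_gt0) (ltW rho1)
  delta0.
- by move=> i /andP[_]; rewrite subnKC// => iM; exact: dyn_rho.
- by move=> i /andP[_]; rewrite subnKC// => iM; exact: dyn_delta.
- exact: le_trans T6.
move=> _; apply: op_bound_le.
apply: le_trans TG; apply: ler_pM.
- exact: geom_weight_ge0.
- by apply: mulr_ge0 => //; apply: sumr_ge0.
- rewrite -G_geom; apply: geom_weight_mono => //; first exact: ltW.
  by rewrite subnS -!subn1 leq_sub2r ?leq_subr.
- by rewrite ler_pM2l.
Qed.

Lemma gradient_descent_decrease K : f K <= f K0 ->
  f (K - eta *: grad f K) <= f K - eta / 4 * gsqr (gain_at K).
Proof.
move=> KK0; rewrite /f.
rewrite [leLHS](_ : _ = total (stepped K)); last first.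
  by apply: eq_total_cost => t tM; rewrite gradient_step.
apply: (@descent_step _ _ _ A C Q Rv P0 Sg pP0 pSg pQ pRv M (gain_at K) eta w
  mu (cB K0)) => //.
- by move=> t tM; exact: innov_w.
- by move=> t tM; exact: le_trans (weight_trace K tM) (cB_le KK0).
- by move=> t tM; exact: weight_perturb.
Qed.

Lemma gradient_dominance K :
  f K - f Ks <= c1 A C Q Rv f Ks * gsqr (gain_at K).
Proof.
apply: gradient_domination => //.
by move=> t tM; exact: weight_trace.
Qed.

Lemma c1_gt0 : 0 < c1 A C Q Rv f Ks.
Proof. by rewrite divr_gt0// !mulr_gt0// exprn_gt0. Qed.

Lemma gsqr_ge0 k : 0 <= gsqr k.
Proof. by apply: sumr_ge0 => t _; rewrite mulr_ge0// mdotxx_ge0. Qed.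

Lemma gradient_descent_rate (K : nat -> gain R M N m) : K 0%N = K0 ->
  (forall k, K k.+1 = K k - eta *: grad f (K k)) ->
  forall k, f (K k) <= f K0 /\
    f (K k) - f Ks <=
    (1 - 2 * (eta / (8 * c1 A C Q Rv f Ks))) ^+ k * (f K0 - f Ks).
Proof.
move=> K00 KS; set r := 1 - _.
have step k : f (K k) <= f K0 ->
    f (K k.+1) <= f (K k) /\ f (K k.+1) - f Ks <= r * (f (K k) - f Ks).
  move=> KK0; have := gradient_descent_decrease KK0; rewrite -KS.
  have := gsqr_ge0 (gain_at (K k)); have := gradient_dominance (K k).
  set g := gsqr _; set c := c1 _ _ _ _ _ _ => dom g0 dec.
  have c0 : 0 < c := c1_gt0.
  have eg : 0 <= eta / 4 * g by rewrite mulr_ge0// divr_ge0// ltW.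
  split; first lra.
  have : eta / (4 * c) * (f (K k) - f Ks) <= eta / 4 * g.
    have -> : eta / 4 * g = eta / (4 * c) * (c * g) by field; rewrite gt_eqF.
    apply: ler_wpM2l => //; apply: divr_ge0; first exact: ltW.
    by apply: mulr_ge0 => //; exact: ltW.
  have -> : r = 1 - eta / (4 * c) by rewrite /r -/c; field; rewrite gt_eqF.
  lra.
elim=> [|k [IH1 IH2]]; first by rewrite K00 expr0 mul1r.
have [s1 s2] := step k IH1; split; first exact: le_trans IH1.
have [r0|r0] := leP 0 r.
  by rewrite (le_trans s2)// exprS -mulrA ler_wpM2l.
have gap0 K' : 0 <= f K' - f Ks by rewrite subr_ge0.
(* A negative factor rules out multiplying the induction hypothesis by [r]. But the first step gives
   0 <= gap_1 <= r gap_0, so the initial gap is 0 and all later ones vanish by monotonicity. *)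
have fKs : f K0 - f Ks = 0.
  have : f K0 <= f K0 by [].
  rewrite -{1}K00 => /step[_]; rewrite K00.
  have := gap0 (K 1%N); have := gap0 K0.
  move: (f K0 - f Ks) (f (K 1%N) - f Ks) => x y x0 y0 yrx; nra.
rewrite fKs mulr0; have := gap0 K0; lra.
Qed.

End Convergence.

(** * The observability Gramian *)

Section Gramian.
Context {R : realType}.

Lemma observable_ker N m (C : 'M[R]_(m, N)) (A : 'M[R]_N) (x : 'cV[R]_N) :
  observable C A -> (forall i, (i < N)%N -> C *m A ^+ i *m x = 0) -> x = 0.
Proof.
move=> obs Cx.
have /row_fullP[B BO] : row_full (\mxcol_(i < N) (C *m A ^+ i)).
  by rewrite /row_full obs.
rewrite -[x]mul1mx -BO -mulmxA mxcol_mul.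
rewrite (eq_mxcol (B_ := fun=> 0)) => [|i]; last exact: Cx.
by rewrite mxcol0 mulmx0.
Qed.

(** The sum starts at n = 1, so a null vector [x] gives C A^i (A x) = 0 for i < N. Observability
    yields A x = 0, and invertibility of [A] yields x = 0. *)
Lemma gramian_posdef N m (C : 'M[R]_(m, N)) (A : 'M[R]_N) :
  observable C A -> A \in unitmx -> posdef (gramian A C).
Proof.
move=> obs uA; apply/posdefE; split.
  rewrite /gramian raddf_sum; apply: eq_bigr => n _.
  by rewrite /= trmx_mul trmxK.
move=> x x0; have gE : mdot x (gramian A C *m x) =
    \sum_(1 <= n < N.+1) mdot (C *m A ^+ n *m x) (C *m A ^+ n *m x).
  rewrite /gramian mulmx_suml /mdot mulmx_sumr raddf_sum.
  by apply: eq_bigr => n _; rewrite -mulmxA mulmxA -trmx_mul.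
rewrite gE lt_def; apply/andP; split; last first.
  by apply: sumr_ge0 => n _; exact: mdotxx_ge0.
apply: contra x0; rewrite big_add1 big_mkord /=.
rewrite psumr_eq0 => [/allP h|n _]; last first.
  exact: mdotxx_ge0.
have Ax : A *m x = 0.
  apply: (observable_ker obs) => i iN.
  have := h (Ordinal iN) (mem_index_enum _).
  by rewrite /= mdotxx_eq0 exprSr => /eqP; rewrite !mulmxA.
by rewrite -[x]mul1mx -(mulVmx uA) -mulmxA Ax mulmx0.
Qed.

End Gramian.

(** * Cross moments from independence *)

Section Noise.
Context {R : realType} {d : measure_display} {Omega : measurableType d}.
Variable P : probability Omega R.
Local Open Scope classical_set_scope.

Lemma pairwise_independent (I : choiceType) (F : I -> set (set Omega)) i j E G :
  mutually_independent P F -> i != j -> F i E -> F j G ->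
  P (E `&` G) = (P E * P G)%E.
Proof.
move=> indep ij Fi Fj.
pose H k := if k == i then E else G.
have Hi : H i = E by rewrite /H eqxx.
have Hj : H j = G by rewrite /H eq_sym (negPf ij).
have := indep [fset i; j]%fset H.
rewrite big_fsetU1 ?inE//= big_seq_fset1 Hi Hj => <-.
  congr (P _); apply/seteqP; split=> [om [Eo Go] k /=|om h].
    by rewrite !inE => /orP[/eqP->|/eqP->]; rewrite ?Hi ?Hj.
  split; [rewrite -Hi|rewrite -Hj]; apply: h; rewrite /= !inE eqxx ?orbT//.
by move=> k; rewrite !inE => /orP[/eqP->|/eqP->]; rewrite ?Hi ?Hj.
Qed.

Lemma sigma_of_coord n (X : Omega -> 'cV[R]_n) i (B : set R) : measurable B ->
  sigma_of X ((fun o => X o i 0) @^-1` B).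
Proof. by move=> mB; apply: sub_sigma_algebra; exists i, B. Qed.

Definition measurable_vector n (X : Omega -> 'cV[R]_n) :=
  forall i, measurable_fun setT (fun o => X o i 0).

Lemma has_mean_expectation n (X : Omega -> 'cV[R]_n) c i :
  measurable_vector X -> has_mean P X c ->
  has_expectation P (fun o => X o i 0) (c i 0).
Proof. by move=> mX Xc; apply: finite_has_expectation. Qed.

Lemma second_moment_cross n (X : Omega -> 'cV[R]_n) S :
  measurable_vector X -> has_second_moment P X S -> has_cross_moment P X X S.
Proof.
move=> mX XS i j; apply: finite_has_expectation.
  exact: measurable_funM.
rewrite -XS; congr ('E_P[_])%E; apply/funext => o.
by rewrite mxE big_ord1 mxE.
Qed.

Lemma independent_cross_moment (I : choiceType) (F : I -> set (set Omega)) i j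
    p q (X : Omega -> 'cV[R]_p) (Y : Omega -> 'cV[R]_q) c :
  mutually_independent P F -> i != j -> F i = sigma_of X -> F j = sigma_of Y ->
  measurable_vector X -> measurable_vector Y ->
  has_mean P X c -> has_mean P Y 0 -> has_cross_moment P X Y 0.
Proof.
move=> indep ij FX FY mX mY Xc Y0 k l; rewrite mxE.
rewrite -(mulr0 (c k 0)); apply: independent_expectation => //.
- move=> A B mA mB; apply: (pairwise_independent indep ij).
    by rewrite FX; exact: sigma_of_coord.
  by rewrite FY; exact: sigma_of_coord.
- exact: has_mean_expectation.
- by have := has_mean_expectation l mY Y0; rewrite mxE.
Qed.

(** Independence is given for [x0], whereas the error starts at [x0 - xbar0]; the constant
    contributes c times the zero mean of [Y]. *)
Lemma has_cross_moment_shift p q (X : Omega -> 'cV[R]_p) (Y : Omega -> 'cV[R]_q)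
    c : measurable_vector Y -> has_mean P Y 0 -> has_cross_moment P X Y 0 ->
  has_cross_moment P (fun o => X o - c) Y 0.
Proof.
move=> mY Y0 XY i j.
have := has_expectationD (XY i j)
  (has_expectationZ (- c i 0) (has_mean_expectation j mY Y0)).
rewrite !mxE mulr0 addr0; congr has_expectation; apply/funext => o.
by rewrite !mxE mulrBl mulNr.
Qed.

(** The quadratic form at [x] is the expectation of the square of <x, X>. *)
Lemma cross_moment_psd n (X : Omega -> 'cV[R]_n) S :
  has_cross_moment P X X S -> psd S.
Proof.
move=> XX; split=> [|x].
  have XX' := has_cross_momentC XX.
  apply/matrixP => i j; have [_] := XX i j; have [_] := XX' i j.
  by rewrite /= => -> [].
have [_ h] : has_expectation P
    (fun o => \sum_i \sum_j x i 0 * x j 0 * (X o i 0 * X o j 0))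
    (\sum_i \sum_j x i 0 * x j 0 * S i j).
  apply: has_expectation_sum => i; apply: has_expectation_sum => j.
  exact: has_expectationZ.
have -> : mdot x (S *m x) = \sum_i \sum_j x i 0 * x j 0 * S i j.
  rewrite mdotE big_ord1; apply: eq_bigr => i _; rewrite mxE mulr_sumr.
  by apply: eq_bigr => j _; rewrite mulrCA mulrA mulrC; ring.
rewrite -lee_fin -h; apply: integral_ge0 => o _; rewrite lee_fin.
rewrite [leRHS](_ : _ = (\sum_i x i 0 * X o i 0) ^+ 2) ?sqr_ge0//.
rewrite expr2 mulr_suml; apply: eq_bigr => i _; rewrite mulr_sumr.
by apply: eq_bigr => j _; ring.
Qed.

End Noise.

(* Holds for all b because of the conventions [a / 0 = 0] in R and
   [a / 0 = +oo] in the extended reals. *)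
Lemma mulr_le_of_le_div (R : realType) (x a b : R) : 0 <= x -> 0 <= a ->
  x <= a / b -> x * b <= a.
Proof.
move=> x0 a0; have [b_gt0|b_le0] := ltP 0 b; first by rewrite ler_pdivlMr.
by move=> _; rewrite (le_trans _ a0)// mulr_ge0_le0.
Qed.

Lemma mulr_le_of_lee_div (R : realType) (x a b : R) : 0 <= x -> 0 <= a ->
  (x%:E <= a%:E / b%:E)%E -> x * b <= a.
Proof.
move=> x0 a0; rewrite inver; have [->|b0] := eqVneq b 0.
  by rewrite mulr0.
by rewrite -EFinM lee_fin; exact: mulr_le_of_le_div.
Qed.

Theorem theorem3 (R : realType) (d : measure_display) (Omega : measurableType d)
  (P : probability Omega R)
  (M N m : nat) (M_gt0 : (0 < M)%N) (N_gt0 : (0 < N)%N) (m_gt0 : (0 < m)%N)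
  (A : 'M[R]_N) (C : 'M[R]_(m, N))
  (Q : nat -> 'M[R]_N) (Rv : nat -> 'M[R]_m)
  (xbar0 : 'cV[R]_N) (Sigma0 : 'M[R]_N)
  (x0 : Omega -> 'cV[R]_N) (w : nat -> Omega -> 'cV[R]_N)
  (v : nat -> Omega -> 'cV[R]_m)
  (x0_normal : multinormal P x0 xbar0 Sigma0)
  (w_gauss : forall t, gaussian_vector P (w t))
  (w_mean : forall t, has_mean P (w t) 0)
  (w_cov : forall t, has_second_moment P (w t) (Q t))
  (v_gauss : forall t, gaussian_vector P (v t))
  (v_mean : forall t, has_mean P (v t) 0)
  (v_cov : forall t, has_second_moment P (v t) (Rv t))
  (indep : mutually_independent P (noise_sigma x0 w v))
  (Q_posdef : forall t, posdef (Q t)) (Rv_posdef : forall t, posdef (Rv t))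
  (CA_obs : observable C A) (A_inv : A \in unitmx) :
  let f : gain R M N m -> R := cost P A C xbar0 x0 w v in
  let P0 : 'M[R]_N := second_moment P (fun o => x0 o - xbar0) in
  forall (Kstar : gain R M N m) (Kstar_min : forall K, f Kstar <= f K)
    (b : R) (b_gt0 : 0 < b)
    (eta : R) (eta_gt0 : 0 < eta)
    (K : nat -> gain R M N m)
    (eta_le : (eta%:E <= Order.min (c3 A C Q Rv P0 f Kstar b (K 0%N))
                                   (c4 A C Q Rv P0 f (K 0%N))%:E)%E)
    (K_step : forall k, K k.+1 = K k - eta *: grad f (K k)),
  let alpha : R := eta / (8 * c1 A C Q Rv f Kstar) in
  forall k : nat,
    f (K k.+1) - f Kstar <= (1 - 2 * alpha) ^+ k.+1 * (f (K 0%N) - f Kstar).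
Proof.
move=> f P0 Ks Ks_min b b_gt0 eta eta_gt0 K eta_le K_step alpha k.
have [x0_gauss x0_mean x0_cov] := x0_normal.
have mx0 : measurable_vector x0 by case: x0_gauss.
have mw t : measurable_vector (w t) by case: (w_gauss t).
have mv t : measurable_vector (v t) by case: (v_gauss t).
have mx0c : measurable_vector (fun o => x0 o - xbar0).
  move=> i; rewrite (_ : (fun _ => _) = (fun o => x0 o i 0 - xbar0 i 0)).
    exact: measurable_funB.
  by apply/funext => o; rewrite !mxE.
have x0x0 := second_moment_cross mx0c x0_cov.
have ww s t : has_cross_moment P (w s) (w t) (if s == t then Q s else 0).
  have [<-|st] := eqVneq s t; first exact: second_moment_cross.
  exact: (independent_cross_moment (i := Some (inl s)) (j := Some (inl t))
    indep).
have vv s t : has_cross_moment P (v s) (v t) (if s == t then Rv s else 0).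
  have [<-|st] := eqVneq s t; first exact: second_moment_cross.
  exact: (independent_cross_moment (i := Some (inr s)) (j := Some (inr t))
    indep).
have wv s t : has_cross_moment P (w s) (v t) 0.
  exact: (independent_cross_moment (i := Some (inl s)) (j := Some (inr t))
    indep).
have x0w t : has_cross_moment P (fun o => x0 o - xbar0) (w t) 0.
  apply: has_cross_moment_shift => //.
  exact: (independent_cross_moment (i := None) (j := Some (inl t))
    indep).
have x0v t : has_cross_moment P (fun o => x0 o - xbar0) (v t) 0.
  apply: has_cross_moment_shift => //.
  exact: (independent_cross_moment (i := None) (j := Some (inr t))
    indep).
have P0E : P0 = Sigma0.
  by apply/matrixP => i j; rewrite mxE x0_cov.
(* From here on the cost is a deterministic function of the gains; the noise has entered through its
   cross moments. *)
have fE : f = fun K => total_cost A C Q Rv P0 (gramian A C) (gain_at K) M.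
  by apply/funext => K'; rewrite P0E; exact: costE.
have pP0 : psd P0 by rewrite P0E; exact: cross_moment_psd x0x0.
have pSg := gramian_posdef CA_obs A_inv.
move: eta_le Ks_min K_step @alpha; rewrite fE => eta_le Ks_min K_step.
move: eta_le; rewrite le_min => /andP[eta3 eta4].
have mu_gt0 := sigma_min_gt0 N_gt0 pSg.
have min_ge0 : 0 <= Num.min 1 (sigma_min (gramian A C)).
  by rewrite le_min ler01 ltW.
have h3 := mulr_le_of_lee_div (ltW eta_gt0) min_ge0 eta3.
rewrite lee_fin /c4 -[leRHS]mul1r in eta4.
have h4 := mulr_le_of_le_div (ltW eta_gt0) ler01 eta4.
by have [] := gradient_descent_rate M_gt0 N_gt0 m_gt0 pP0 A_inv pSg Q_posdef
  Rv_posdef Ks_min b_gt0 eta_gt0 h3 h4 erefl K_step k.+1.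
Qed.
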